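(* Let $n\ge 6$ and $d\in\{3,\dots,\lfloor n/2\rfloor\}$. Then $\mathring\mu_n(d\mid d)_1\le 2d$.
   Context: $\mathbb{R}^n$ and $\Lambda^2(\mathbb{R}^n)$ carry their canonical Euclidean norms. **Rational subspaces.** A linear subspace $B$ of $\mathbb{R}^n$ is rational if it has a basis of vectors with rational coordinates; $\mathfrak{R}_n(e)$ is the set of rational subspaces of $\mathbb{R}^n$ of dimension $e$. **Height.** For $B\in\mathfrak{R}_n(e)$, the Plücker coordinates of $B$ are the $\binom{n}{e}$ minors of size $e\times e$ of an $n\times e$ matrix whose columns form a basis of $B$ (well defined up to a nonzero scalar); choosing a representative $\Xi$ with integer coordinates with gcd $1$, set $H(B)=\|\Xi\|$ (Euclidean norm). **Angles.** For nonzero $X,Y\in\mathbb{R}^n$ let $\psi(X,Y)=\|X\wedge Y\|/(\|X\|\,\|Y\|)$ (sine of the angle). For subspaces $A,B$ of dimensions $d,e\ge 1$ and $t=\min(d,e)$, define $\psi_1(A,B),\dots,\psi_t(A,B)$ recursively: $\psi_1(A,B)=\min\psi(X,Y)$ over $X\in A\setminus\{0\}$, $Y\in B\setminus\{0\}$, attained at unit vectors $X_1,Y_1$; given $(X_1,Y_1),\dots,(X_j,Y_j)$, $\psi_{j+1}(A,B)=\min\psi(X,Y)$ over nonzero $X\in A$ orthogonal to $X_1,\dots,X_j$ and nonzero $Y\in B$ orthogonal to $Y_1,\dots,Y_j$, attained at unit vectors $X_{j+1},Y_{j+1}$. (These numbers do not depend on the choices.) **Irrationality and exponents.** Let $d,e\in\{1,\dots,n-1\}$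 with $d+e\le n$ and $1\le j\le\min(d,e)$. $\mathfrak{I}_n(d,e)_j$ is the set of $d$-dimensional subspaces $A$ of $\mathbb{R}^n$ with $\dim(A\cap B)<j$ for all $B\in\mathfrak{R}_n(e)$. For $A\in\mathfrak{I}_n(d,e)_j$, $\mu_n(A\mid e)_j\in(0,+\infty]$ is the supremum of the $\beta>0$ such that $\psi_j(A,B)\le H(B)^{-\beta}$ for infinitely many $B\in\mathfrak{R}_n(e)$. Finally $\mathring\mu_n(d\mid e)_j=\inf_{A\in\mathfrak{I}_n(d,e)_j}\mu_n(A\mid e)_j$. *)

(* Defs.v *)
From HB Require Import structures.
From mathcomp Require Import all_boot all_order all_algebra.
From mathcomp Require Import all_classical all_reals all_analysis.
Set Implicit Arguments.
Unset Strict Implicit.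
Unset Printing Implicit Defensive.
Import Order.TTheory GRing.Theory Num.Theory.
Local Open Scope classical_set_scope.
Local Open Scope ring_scope.

(* R^n is 'rV[R]_n; its linear subspaces are the elements of {vspace 'rV[R]_n}. *)

Definition l2norm (R : realType) (I : finType) (P : pred I) (x : I -> R) : R :=
  Num.sqrt (\sum_(i | P i) x i ^+ 2).

Definition dotv (R : realType) (n : nat) (x y : 'rV[R]_n) : R :=
  \sum_(i < n) x 0 i * y 0 i.

Definition normv (R : realType) (n : nat) (x : 'rV[R]_n) : R :=
  l2norm xpredT (x 0).

(* Norm of x /\ y for the Euclidean structure on the exterior square in which
   the e_i /\ e_j (i < j) are orthonormal. *)
Definition norm_wedge (R : realType) (n : nat) (x y : 'rV[R]_n) : R :=
  l2norm (fun ij : 'I_n * 'I_n => (ij.1 < ij.2)%N)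
         (fun ij => x 0 ij.1 * y 0 ij.2 - x 0 ij.2 * y 0 ij.1).

Definition sin_angle (R : realType) (n : nat) (x y : 'rV[R]_n) : R :=
  norm_wedge x y / (normv x * normv y).

Definition admissible (R : realType) (n : nat) (A : {vspace 'rV[R]_n})
    (X : nat -> 'rV[R]_n) (k : nat) (x : 'rV[R]_n) : Prop :=
  [/\ x \in A, x != 0 & forall i, (i < k)%N -> dotv (X i) x = 0].

(* Indices are shifted: X k and Y k are the vectors X_{k+1} and Y_{k+1} of the
   recursive definition of the angles. *)
Definition principal_vectors (R : realType) (n : nat)
    (A B : {vspace 'rV[R]_n}) (X Y : nat -> 'rV[R]_n) (j : nat) : Prop :=
  forall k, (k < j)%N ->
    [/\ admissible A X k (X k) /\ normv (X k) = 1,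
        admissible B Y k (Y k) /\ normv (Y k) = 1 &
        forall x y, admissible A X k x -> admissible B Y k y ->
          sin_angle (X k) (Y k) <= sin_angle x y].

(* psi_j(A, B), for 1 <= j <= min(dim A, dim B): in this range the set below is
   a singleton, so the default value 0 is not used. *)
Definition psi (R : realType) (n : nat) (A B : {vspace 'rV[R]_n}) (j : nat)
    : R :=
  xget 0 [set r | exists X Y, principal_vectors A B X Y j /\
                              r = sin_angle (X j.-1) (Y j.-1)].

Definition rational_subspace (R : realType) (n : nat) (B : {vspace 'rV[R]_n})
    : Prop :=
  exists2 b : seq 'rV[R]_n, basis_of B b &
    forall v, v \in b -> forall i, exists q : rat, v 0 i = ratr q.

Definition rational_subspaces (R : realType) (n e : nat)
    : set {vspace 'rV[R]_n} :=
  [set B | rational_subspace B /\ \dim B = e].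

(* The e x e minors of an n x e matrix are indexed by the increasing maps
   'I_e -> 'I_n selecting their rows. *)
Definition increasing_map (e n : nat) (f : {ffun 'I_e -> 'I_n}) : bool :=
  [forall i : 'I_e, forall j : 'I_e, (i < j)%N ==> (f i < f j)%N].

Definition basis_mx (R : realType) (n e : nat) (b : e.-tuple 'rV[R]_n)
    : 'M[R]_(n, e) :=
  \matrix_(i, j) tnth b j 0 i.

Definition primitive_plucker (R : realType) (n : nat) (B : {vspace 'rV[R]_n})
    (Xi : {ffun 'I_(\dim B) -> 'I_n} -> int) : Prop :=
  (exists (b : (\dim B).-tuple 'rV[R]_n) (c : R),
     [/\ basis_of B b, c != 0 &
         forall f, increasing_map f ->
           (Xi f)%:~R = c * \det (rowsub f (basis_mx b))]) /\
  \big[gcdn/0%N]_(f | increasing_map f) `|Xi f|%N = 1%N.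

(* For rational B the vector Xi is unique up to sign, so the set below is a
   singleton; the value 0 is only taken at non-rational B. *)
Definition height (R : realType) (n : nat) (B : {vspace 'rV[R]_n}) : R :=
  xget 0 [set h | exists2 Xi : {ffun 'I_(\dim B) -> 'I_n} -> int,
                    @primitive_plucker R n B Xi &
                    h = l2norm (@increasing_map _ _) (fun f => (Xi f)%:~R)].

Definition irrational_subspaces (R : realType) (n d e j : nat)
    : set {vspace 'rV[R]_n} :=
  [set A | \dim A = d /\
           forall B, @rational_subspaces R n e B -> (\dim (A :&: B) < j)%N].

Definition mu (R : realType) (n : nat) (A : {vspace 'rV[R]_n}) (e j : nat)
    : \bar R :=
  ereal_sup [set beta%:E | beta in [set beta : R | 0 < beta /\
    infinite_set [set B | @rational_subspaces R n e B /\
                          psi A B j <= height B `^ (- beta)]]].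

Definition mu_ring (R : realType) (n d e j : nat) : \bar R :=
  ereal_inf [set mu A e j | A in @irrational_subspaces R n d e j].

(* Main.v *)
From HB Require Import structures.
Require Import Defs.
From mathcomp Require Import all_boot all_order all_algebra.
From mathcomp Require Import all_fingroup all_solvable all_field.
From mathcomp Require Import all_classical all_reals all_analysis.
From mathcomp Require Import complex ring zify.

(** Put m = 2d.  The subspace A that realises the bound comes from a real cyclic
    field K of degree m over the rationals, with s a generator of its Galois
    group.  Let eta_0, ..., eta_(m-1) be a basis of K made of conjugate algebraic
    integers, s eta_k = eta_(k+1) with indices modulo m, and let
    L_t(x) = sum_(k < m) eta_(t+k) x_k for t modulo m.  Then A is the set of the
    x in R^m x 0 with L_0(x) = ... = L_(d-1)(x) = 0; it has dimension m - d = d.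

    Suppose first that n = m.  Let B be rational of dimension d, with primitive
    Pluecker vector Xi.  The determinant of L_t, ..., L_(t+d-1) on a basis of B is,
    up to a factor that depends on the basis only, a linear form in Xi with
    coefficients in Z[eta_0, ..., eta_(m-1)]; let D_t be the value of that form.
    Thus D_t is an algebraic integer of K, and s maps D_t to D_(t+1).

    - D_t is not 0: the determinant of the s^i(b_j), i, j < d, is not 0 when the
      b_j in K are linearly independent over the fixed field of s, which is the
      field of rationals (moore_det_neq0, the analogue for s of the Wronskian
      criterion).  In particular A meets B in 0.
    - The product of D_0, ..., D_(m-1) is an algebraic integer fixed by s, hence
      a nonzero rational integer, of absolute value at least 1.  As every
      |D_t| is O(H(B)), it follows that |D_0| >= c H(B)^(1-m).
    - If a unit vector y of B is at distance e from A, then L_0, ..., L_(d-1)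
      are O(e) at y; expressing y in a well conditioned basis of B gives
      |D_0| = O(e H(B)).

    Together psi_1(A, B) >= c H(B)^(-m) (hankel_lower_bound, psi_lower_bound).  An
    exponent larger than m would thus bound H(B), and only finitely many rational
    subspaces have bounded height (northcott).

    When n > m, B may meet 0 x R^(n-m), and D_0 then vanishes.  So R^n is first
    folded onto R^m by a linear map that is the identity on R^m x 0, sends
    every other basis vector to a basis vector of R^m or to 0, and is injective on
    B (exists_injective_folding).  There are finitely many such maps, so the
    constants remain uniform, and nothing changes on A.

    The field K is the subfield of degree m of the p-th cyclotomic field, for a
    prime p congruent to 1 modulo 2m (exists_prime_1mod), and the eta_k are its
    Gaussian periods (gaussian_periods).  The congruence modulo 2m, rather than
    modulo m, makes K real. *)

Set Implicit Arguments.
Unset Strict Implicit.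
Unset Printing Implicit Defensive.
Import Order.TTheory GRing.Theory Num.Theory.
Import numFieldNormedType.Exports.
Local Open Scope classical_set_scope.
Local Open Scope ring_scope.

(** * The Moore determinant of an automorphism *)

(** The induction removes one b_j.  A relation between the columns, normalised to
    have some coefficient y_j0 = 1, is determined by the rows i < r; applying s
    to these and comparing with the rows shifted by one shows that the s(y_j)
    are again the y_j.  So the relation has coefficients fixed by s, and its row
    i = 0 is a linear relation between the b_j over the fixed field. *)
Lemma moore_det_neq0 (L : fieldType) (s : {rmorphism L -> L}) r (b : 'I_r -> L) :
    (forall q : 'I_r -> L, (forall j, s (q j) = q j) ->
       \sum_j q j * b j = 0 -> forall j, q j = 0) ->
  \det (\matrix_(i < r, j < r) iter i s (b j)) != 0.
Proof.
elim: r b => [|r IHr] b free_b; first by rewrite det_mx00 oner_eq0.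
apply/negP; rewrite -det_tr => /det0P [v nz_v vM0].
have /rV0Pn [j0 nz_vj0] := nz_v.
pose y j := v 0 j / v 0 j0.
have y_rel (i : 'I_r.+1) : \sum_j y j * iter i s (b j) = 0.
  have /rowP/(_ i) := vM0; rewrite !mxE => vMi0.
  apply: (mulfI nz_vj0); rewrite mulr0 -[RHS]vMi0 mulr_sumr.
  by apply: eq_bigr => j _; rewrite !mxE mulrA [v 0 j0 * _]mulrC divfK.
pose b' j := b (lift j0 j).
have free_b' (q : 'I_r -> L) : (forall j, s (q j) = q j) ->
    \sum_j q j * b' j = 0 -> forall j, q j = 0.
  move=> sq q0 j; pose q1 k := oapp q 0 (unlift j0 k).
  have := free_b q1 _ _ (lift j0 j); rewrite /q1 liftK /=; apply.
    by move=> k; case: (unlift j0 k) => [k'|] /=; rewrite ?rmorph0 ?sq.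
  rewrite (bigD1_ord j0) //= unlift_none mul0r add0r -[RHS]q0.
  by apply: eq_bigr => k _; rewrite liftK.
have {IHr free_b'} := IHr _ free_b'.
set M := (X in \det X) => nz_detM.
have det_sM : \det (map_mx s M)^T != 0 by rewrite det_tr det_map_mx fmorph_eq0.
(* Subtracting row i + 1 from the image by s of row i cancels the column j0. *)
pose w := \row_j (s (y (lift j0 j)) - y (lift j0 j)).
have wM : w *m (map_mx s M)^T = 0.
  apply/rowP=> i; rewrite !mxE.
  have -> : \sum_j w 0 j * (map_mx s M)^T j i =
     s (\sum_j y j * iter i s (b j)) - \sum_j y j * iter (lift ord0 i) s (b j).
    rewrite rmorph_sum -sumrB [RHS](bigD1_ord j0) //=.
    rewrite rmorphM /= add0n -mulrBl /y divff // rmorph1 subrr mul0r add0r.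
    by apply: eq_bigr => j _; rewrite !mxE [in RHS]rmorphM mulrBl.
  have /= -> := y_rel (widen_ord (leqnSn r) i).
  have /= -> := y_rel (lift ord0 i).
  by rewrite rmorph0 subrr.
have w0 : w = 0.
  by apply/eqP; apply: contraNT det_sM => nz_w; apply/det0P; exists w.
have sy j : s (y j) = y j.
  case: (unliftP j0 j) => [k ->|->]; last by rewrite /y divff ?rmorph1.
  by apply/eqP; rewrite -subr_eq0; move/rowP/(_ k): w0; rewrite !mxE => ->.
have /(_ j0)/eqP := free_b y sy (y_rel ord0).
by rewrite /y divff ?oner_eq0.
Qed.

(** * Primes congruent to 1 modulo n *)

(** Every factor x - z of the value at x is at least x - 1 in absolute value. *)
Lemma Cyclotomic_gt1 n x : (1 < n)%N -> (2 < x)%N -> (1 < `|('Phi_n).[x%:Z]|)%N.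
Proof.
move=> n_gt1 x_gt2; have [z prim_z] := C_prim_root_exists (ltnW n_gt1).
have z1 : `|z| = 1.
  apply/eqP; rewrite -(@pexpr_eq1 _ _ n) ?(ltnW n_gt1) //.
  by rewrite -normrX prim_expr_order ?normr1.
have norm_ge2 k : 2 <= `|x%:R - z ^+ k|.
  apply: le_trans (lerB_dist _ _); rewrite normrX z1 expr1n normr_nat lerBrDr.
  by rewrite natr1 ler_nat.
rewrite -ltz_nat -(ltr_int algC) abszE intr_norm.
have -> : (('Phi_n).[x%:Z])%:~R = (cyclotomic z n).[x%:R].
  by rewrite -(Cintr_Cyclotomic prim_z) -[x%:R]/(x%:Z%:~R) horner_map.
rewrite /cyclotomic horner_prod normr_prod.
rewrite (bigD1 (Ordinal n_gt1)) ?coprime1n //= !hornerE.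
apply: (@lt_le_trans _ _ (2 * 1)); first by rewrite mulr1 ltr1n.
apply: ler_pM; rewrite ?ler0n ?ler01 // ?hornerXsubC //.
apply: (big_ind (fun t => 1 <= t)) => [||k _]; rewrite ?hornerXsubC //.
  exact: mulr_ege1.
by apply: le_trans (norm_ge2 k); rewrite ler1n.
Qed.

(** A prime factor p of the value of the n-th cyclotomic polynomial at a multiple x
    of n does not divide x, hence not n, so X^n - 1 is separable modulo p.  If the
    order of x modulo p were a proper divisor m of n, then x would be a common
    root of X^m - 1 and of the n-th cyclotomic polynomial, a double root of
    X^n - 1.  So x has order n in a group of order p - 1. *)
Lemma exists_prime_1mod n : (0 < n)%N -> exists2 p, prime p & (n %| p.-1)%N.
Proof.
rewrite leq_eqVlt => /orP[/eqP <-|n_gt1]; first by exists 2%N.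
have n_gt0 := ltnW n_gt1.
(* The factor 3 makes the value at x different from 1 and -1. *)
pose x := (3 * n)%N; pose a := `|('Phi_n).[x%:Z]|%N.
have a_gt1 : (1 < a)%N by apply: Cyclotomic_gt1; rewrite // /x leq_pmulr.
exists (pdiv a); first exact: pdiv_prime.
set p := pdiv a; have p_pr : prime p by apply: pdiv_prime.
have pcharFp := pchar_Fp p_pr.
pose f : int -> 'F_p := intr; pose y := f x.
have rootPhi : (map_poly f 'Phi_n).[y] = 0.
  rewrite horner_map /f /=; set v := horner _ _.
  have: (p %| `|v|)%N by apply: pdiv_dvd.
  rewrite (dvdn_pcharf pcharFp) /= => /eqP v0.
  by rewrite [v]intEsign rmorphM /= /f -pmulrn v0 mulr0.
pose Q m : {poly 'F_p} := \prod_(d <- divisors m) map_poly f 'Phi_d.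
have QE m : (0 < m)%N -> Q m = 'X^m - 1.
  by move=> /prod_Cyclotomic/(congr1 (map_poly f));
     rewrite rmorph_prod rmorphB /= map_polyXn rmorph1.
have yn1 : y ^+ n = 1.
  apply/eqP; rewrite -subr_eq0.
  have := congr1 (horner^~ y) (QE n n_gt0); rewrite !hornerE => <-.
  rewrite /Q horner_prod (big_rem n) /= ?rootPhi ?mul0r //.
  by rewrite -dvdn_divisors.
have nz_y : y != 0.
  apply/eqP=> y0; move/eqP: yn1.
  by rewrite y0 expr0n eqn0Ngt n_gt0 eq_sym oner_eq0.
have nz_n : n%:R != 0 :> 'F_p.
  apply: contraNneq nz_y => n0.
  by rewrite /y /f /x -pmulrn natrM n0 mulr0.
have [m prim_m dv_mn] := prim_order_exists n_gt0 yn1.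
have [eq_mn|neq_mn] := eqVneq m n.
  rewrite -eq_mn; rewrite (prim_order_dvd prim_m); apply/eqP.
  apply: (mulfI nz_y); rewrite -exprS mulr1 prednK ?prime_gt0 //.
  by have := expf_card y; rewrite card_Fp.
have m_gt0 := prim_order_gt0 prim_m.
have [T QT] : exists T, Q n = Q m * (map_poly f 'Phi_n * T).
  rewrite /Q (bigID (fun d => d %| m)%N) /=.
  rewrite -big_filter -(big_filter _ (fun d => ~~ (d %| m)%N)).
  have perm_m : perm_eq [seq d <- divisors n | (d %| m)%N] (divisors m).
    apply: uniq_perm; rewrite ?filter_uniq ?divisors_uniq // => d.
    rewrite mem_filter -!dvdn_divisors //.
    by apply: andb_idr => dm; apply: dvdn_trans dv_mn.
  rewrite (perm_big _ perm_m) /= [X in _ * X](big_rem n) /=; last first.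
    rewrite mem_filter -dvdn_divisors // dvdnn andbT.
    apply: contra neq_mn => nm; by rewrite eqn_dvd dv_mn nm.
  by eexists.
(* Both cofactors of the derivative vanish at the double root y, whereas the
   derivative of X^n - 1 does not. *)
have := congr1 (fun P => P^`().[y]) QT.
rewrite !derivM QE // QE // derivB derivXn derivC subr0.
rewrite !(hornerD, hornerM, hornerN, hornerMn, hornerXn, hornerC) rootPhi.
rewrite (prim_expr_order prim_m) subrr !(mul0r, mulr0, addr0).
move/eqP; rewrite -mulr_natr mulf_eq0 (negPf nz_n) orbF expf_eq0 (negPf nz_y) andbF.
by [].
Qed.

(** * Rational relations between the p-th roots of unity *)

Lemma sum_powers_unity_root (F : fieldType) p (z : F) :
  z ^+ p = 1 -> (z != 1) -> \sum_(i < p) z ^+ i = 0.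
Proof.
move=> zp1; rewrite -subr_eq0 => nz_z; apply: (mulfI nz_z).
by rewrite -subrX1 zp1 subrr mulr0.
Qed.

Lemma sum_powers_poly p : \poly_(i < p) 1 = \sum_(i < p) 'X^i :> {poly rat}.
Proof. by rewrite poly_def; apply: eq_bigr => i _; rewrite scale1r. Qed.

Lemma root_sum_powers (K : numFieldType) p (x : K) :
  x ^+ p = 1 -> x != 1 -> (map_poly ratr (\poly_(i < p) 1)).[x] = 0.
Proof.
move=> xp1 x1; rewrite sum_powers_poly rmorph_sum horner_sum.
rewrite -[RHS](sum_powers_unity_root xp1 x1).
by apply: eq_bigr => i _; rewrite /= map_polyXn hornerXn.
Qed.

(** The irreducibility of the p-th cyclotomic polynomial, in the form that carries
    over to the roots of unity of an arbitrary field C.  The only irreducibility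
    statement used is about complex algebraic numbers: the gcd of P and
    1 + ... + X^(p-1) has a root in C, hence one among the algebraic numbers,
    whose minimal polynomial is 1 + ... + X^(p-1) and divides P. *)
Lemma sum_powers_dvdp (C : numFieldType) p (z : C) (P : {poly rat}) :
    prime p -> p.-primitive_root z ->
  (map_poly ratr P).[z] = 0 -> \poly_(i < p) 1 %| P.
Proof.
move=> p_pr prim_z Pz0; set Phi := \poly_(i < p) 1.
have PhiS : Phi = \sum_(i < p) 'X^i by exact: sum_powers_poly.
have PhiE (K : numFieldType) : (map_poly (@ratr K) Phi) * ('X - 1) = 'X^p - 1.
  by rewrite PhiS rmorph_sum mulrC [RHS]subrX1; congr (_ * _);
     apply: eq_bigr => i _; rewrite /= map_polyXn.
have p_gt1 := prime_gt1 p_pr.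
pose D := gcdp P Phi.
have rootD : root (map_poly (@ratr C) D) z.
  rewrite gcdp_map root_gcd /root Pz0 eqxx /= root_sum_powers //.
    exact: prim_expr_order.
  by rewrite -(prim_order_dvd prim_z 1) dvdn1 gtn_eqF.
have sizeD : size D != 1%N.
  apply: contraTN rootD => /size_poly1P[a nz_a ->].
  by rewrite map_polyC /= rootC fmorph_eq0.
have [w rootDw] : exists w : algC, root (map_poly ratr D) w.
  by apply/closed_rootP; rewrite size_map_poly.
have [q [qE q_monic rootq]] := minCpolyP w.
have /rootP := rootDw; rewrite gcdp_map => /rootP; rewrite root_gcd => /andP[Pw Phiw].
have wp1 : w ^+ p = 1.
  apply/eqP; rewrite -subr_eq0; have := congr1 (horner^~ w) (PhiE algC).
  by rewrite hornerM (rootP Phiw) mul0r !hornerE => <-.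
have w1 : w != 1.
  apply: contraTneq Phiw => ->; rewrite /root PhiS rmorph_sum horner_sum.
  under eq_bigr => i _ do rewrite /= map_polyXn hornerXn expr1n.
  by rewrite sumr_const card_ord pnatr_eq0 -lt0n prime_gt0.
have prim_w : p.-primitive_root w.
  have [m prim_m] := prim_order_exists (prime_gt0 p_pr) wp1.
  have /primeP[_ dvp] := p_pr; move/dvp => /pred2P[m1|<- //]; case/negP: w1.
  by rewrite -(prim_expr_order prim_m) m1 expr1.
have sizePhi : size Phi = p.
  by rewrite size_poly_eq ?oner_eq0.
have sizeq : size q = p.
  rewrite -(size_map_poly (ratr : {rmorphism rat -> algC})) /= -qE.
  by rewrite (minCpoly_cyclotomic prim_w) size_cyclotomic totient_prime ?prednK ?prime_gt0.
have qPhi : q %= Phi by rewrite -dvdp_size_eqp ?sizeq ?sizePhi // -rootq.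
by rewrite -(eqp_dvdl _ qPhi) -rootq.
Qed.

(** The rational relations between 1, z, ..., z^(p-1) are the multiples of
    1 + z + ... + z^(p-1) = 0. *)
Lemma cyclotomic_relation (C : numFieldType) p (z : C) (c : 'I_p -> rat) :
    prime p -> p.-primitive_root z ->
  \sum_(k < p) ratr (c k) * z ^+ k = 0 -> forall k l, c k = c l.
Proof.
move=> p_pr prim_z rel_c.
pose P := \sum_(k < p) c k *: 'X^k.
have cE k : P`_(val k) = c k.
  rewrite coef_sum (bigD1 k) //= coefZ coefXn eqxx mulr1 big1 ?addr0 // => l nlk.
  by rewrite coefZ coefXn (inj_eq val_inj) eq_sym (negPf nlk) mulr0.
have sizeP : (size P <= p)%N.
  apply: leq_trans (size_sum _ _ _) _; apply/bigmax_leqP => k _.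
  by apply: leq_trans (size_scale_leq _ _) _; rewrite size_polyXn.
have /dvdpP[Q PQ] : \poly_(i < p) 1 %| P.
  apply: sum_powers_dvdp p_pr prim_z _.
  rewrite rmorph_sum horner_sum -[RHS]rel_c; apply: eq_bigr => k _.
  by rewrite /= map_polyZ map_polyXn !hornerE.
have sizePhi : size (\poly_(i < p) 1 : {poly rat}) = p.
  by rewrite size_poly_eq ?oner_eq0.
have sizeQ : (size Q <= 1)%N.
  have [->|nzQ] := eqVneq Q 0; first by rewrite size_poly0.
  have nzPhi : \poly_(i < p) 1 != 0 :> {poly rat}.
    by rewrite -size_poly_gt0 sizePhi prime_gt0.
  move: sizeP; rewrite PQ size_mul // sizePhi -(prednK (prime_gt0 p_pr)) addnS /=.
  by rewrite -[X in (_ <= X)%N]add1n leq_add2r.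
move=> k l; by rewrite -!cE PQ (size1_polyC sizeQ) !coefCM !coef_poly !ltn_ord.
Qed.

(** Reduction of the exponents modulo p, uniformly in the p-th root of unity x. *)
Lemma eval_fold (C : numFieldType) p (P : {poly rat}) : (0 < p)%N ->
  exists c : 'I_p -> rat,
    (forall x : C, x ^+ p = 1 ->
       (map_poly ratr P).[x] = \sum_(k < p) ratr (c k) * x ^+ k) /\
    (P \is a polyOver Num.int -> forall k, c k \in Num.int).
Proof.
case: p => // p _.
exists (fun k => \sum_(i < size P | inord (i %% p.+1) == k) P`_i); split; last first.
  by move=> /polyOverP Pint k; apply: rpred_sum.
move=> x xp1; rewrite horner_poly.
rewrite (partition_big (fun i : 'I__ => inord (i %% p.+1) : 'I_p.+1) xpredT) //=.
apply: eq_bigr => k _; rewrite rmorph_sum mulr_suml; apply: eq_bigr => i /eqP <-.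
by rewrite inordK ?ltn_pmod // (expr_mod _ xp1).
Qed.

(** The elements of the p-th cyclotomic field fixed by z |-> z^g are rational, and
    are integers if they lie in Z[z].  Such an element is the sum of the c_k z^k,
    with c_k determined up to a common constant; invariance makes k |-> c_k
    constant on the orbit of 1 under multiplication by g, that is, on all k but 0.
    The element is then c_0 - c_1, because the nontrivial powers of z add up
    to -1. *)
Lemma eval_fixed_rat (C : numFieldType) p (z : C) g (P : {poly rat}) :
    prime p -> p.-primitive_root z -> coprime p g ->
    (forall k, ~~ (p %| k) -> exists j, k = g ^ j %[mod p])%N ->
    (map_poly ratr P).[z ^+ g] = (map_poly ratr P).[z] ->
  exists2 q : rat, (map_poly ratr P).[z] = ratr q &
                   P \is a polyOver Num.int -> q \in Num.int.
Proof.
case: p => // p; move=> p_pr prim_z cop_g gen_g fixP.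
have zp1 := prim_expr_order prim_z.
have [c [cE cint]] := eval_fold C P (prime_gt0 p_pr).
pose mul (k : 'I_p.+1) : 'I_p.+1 := inord (g * k %% p.+1).
have mulE k : mul k = (g * k %% p.+1)%N :> nat by rewrite inordK ?ltn_pmod.
have mul_inj : injective mul.
  move=> k l /(congr1 val); rewrite /= !mulE => /eqP.
  have prim_zg : p.+1.-primitive_root (z ^+ g).
    by rewrite (prim_root_exp_coprime _ prim_z) coprime_sym.
  rewrite -(eq_prim_root_expr prim_z) !exprM (eq_prim_root_expr prim_zg).
  by rewrite !modn_small ?ltn_ord // => /eqP/val_inj.
have c_mul k : c (mul k) = c k.
  (* The relation has coefficient c k - c (k / g) at z^k; the common value of these
     differences is 0, as 0 / g = 0. *)
  have /(_ (mul k) ord0) : forall k l, c k - c (invF mul_inj k) =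
                           c l - c (invF mul_inj l).
    apply: (cyclotomic_relation p_pr prim_z).
    transitivity ((map_poly ratr P).[z] - (map_poly ratr P).[z ^+ g]); last first.
      by rewrite fixP subrr.
    rewrite !cE ?zp1 // -?exprM 1?mulnC ?exprM ?zp1 ?expr1n //.
    rewrite [X in _ = _ - X](reindex_inj (can_inj (f_invF mul_inj))) /= -sumrB.
    apply: eq_bigr => l _; rewrite rmorphB mulrBl; congr (_ - _ * _).
    have lE : l = (g * invF mul_inj l %% p.+1)%N :> nat by rewrite -(mulE (invF mul_inj l)) f_invF.
    by rewrite {1}lE (expr_mod _ zp1) exprM.
  have mul0 : mul ord0 = ord0 by apply: ord_inj; rewrite (mulE ord0) muln0 mod0n.
  by rewrite invF_f -{2}mul0 invF_f subrr => /eqP; rewrite subr_eq0 => /eqP.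
pose k1 : 'I_p.+1 := inord 1.
have k1E : k1 = 1%N :> nat by rewrite inordK // ltnS -ltnS prime_gt1.
have c_const k : k != ord0 -> c k = c k1.
  move=> nz_k; have [|j kE] := gen_g k.
    by rewrite gtnNdvd // lt0n.
  have -> : k = iter j mul k1.
    apply: val_inj; rewrite -[val k](modn_small (ltn_ord k)) kE /=.
    elim: j {kE} => [|j IHj]; first by rewrite expn0 k1E modn_small ?prime_gt1.
    by rewrite iterS mulE -IHj expnS modnMmr.
  by elim: j {kE} => // j IHj; rewrite iterS c_mul.
exists (c ord0 - c k1); last by move=> Pint; rewrite rpredB ?cint.
have sum0 : \sum_(k < p.+1) z ^+ k = 0.
  apply: sum_powers_unity_root => //.
  by rewrite -(prim_order_dvd prim_z 1) dvdn1 gtn_eqF ?prime_gt1.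
transitivity (\sum_(k < p.+1) ratr (c k) * z ^+ k - ratr (c k1) * \sum_(k < p.+1) z ^+ k).
  by rewrite sum0 mulr0 subr0 cE.
rewrite mulr_sumr -sumrB (bigD1 ord0) //= expr0 !mulr1 rmorphB big1 ?addr0 // => k nz_k.
by rewrite c_const ?subrr.
Qed.

(** A primitive root modulo p, through the properties of its powers that are used
    below; the last one is g^((p-1)/2) = -1, as p - 1 represents -1. *)
Lemma exists_primitive_root p : prime p -> (2 < p)%N ->
  exists g : nat,
  [/\ coprime p g,
      (forall k, ~~ (p %| k) -> exists j, k = g ^ j %[mod p])%N,
      (forall i j, (g ^ i == g ^ j %[mod p]) = (i == j %[mod p.-1]))%N
    & (g ^ (p.-1)./2 = p.-1 %[mod p])%N].
Proof.
move=> p_pr p_gt2; have p_gt0 := prime_gt0 p_pr.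
have p1_gt0 : (0 < p.-1)%N by rewrite -subn1 subn_gt0 prime_gt1.
have Fp_unity (x : 'F_p) : x != 0 -> x ^+ p.-1 = 1.
  move=> nz_x; apply: (mulfI nz_x); rewrite -exprS mulr1 prednK //.
  by have := expf_card x; rewrite card_Fp.
have modE m n : (m == n %[mod p])%N = (m%:R == n%:R :> 'F_p).
  by rewrite -(inj_eq val_inj) /= !val_Fp_nat.
have /hasP[x _ prim_x] : has (p.-1).-primitive_root (enum (predC1 (0 : 'F_p))).
  apply: has_prim_root; rewrite ?enum_uniq -?cardE ?cardC1 ?card_Fp //.
  apply/allP=> x; rewrite mem_enum => nz_x.
  by apply/unity_rootP/Fp_unity.
pose g := val x.
have gE : g%:R = x by rewrite natr_Zp.
have nz_x : x != 0.
  apply/eqP=> x0; have /eqP := prim_expr_order prim_x.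
  by rewrite x0 expr0n gtn_eqF // eq_sym oner_eq0.
exists g; split.
- by rewrite prime_coprime // (dvdn_pcharf (pchar_Fp p_pr)) gE.
- move=> k; rewrite (dvdn_pcharf (pchar_Fp p_pr)) => /Fp_unity/(prim_rootP prim_x)[j kE].
  by exists j; apply/eqP; rewrite modE natrX gE kE.
- by move=> i j; rewrite modE !natrX gE (eq_prim_root_expr prim_x).
set e := (p.-1)./2.
apply/eqP; rewrite modE natrX gE -(subn1 p) natrB ?prime_gt0 // pchar_Fp_0 // sub0r.
have eE : (e * 2 = p.-1)%N.
  rewrite muln2 even_halfK //.
  have /even_prime[p2|] := p_pr; first by rewrite p2 in p_gt2.
  by case: (p) => //= p' /negPf->.
have : (x ^+ e) ^+ 2 == 1 by rewrite -exprM eE (prim_expr_order prim_x).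
rewrite sqrf_eq1 => /orP[/eqP xe1|//].
have := prim_order_dvd prim_x e; rewrite xe1 eqxx => /dvdn_leq.
have e_gt0 : (0 < e)%N by rewrite -(ltn_pmul2r (isT : 0 < 2)%N) eE.
by move=> /(_ e_gt0); rewrite -eE leqNgt ltn_Pmulr.
Qed.

(** * The cyclotomic field and its automorphisms *)

(** Q(z) as a field L embedded in C, with the automorphism s that maps z to z^g.
    Elements of L are represented by rational polynomials, and s substitutes X^g
    for X in a representative; this is well defined because a rational polynomial
    that vanishes at z vanishes at all its conjugates. *)
Lemma cyclotomic_field (C : numFieldType) p (z : C) g :
    prime p -> p.-primitive_root z -> coprime p g ->
  exists (L : fieldType) (iota : {rmorphism L -> C}) (s : {rmorphism L -> L}),
    (forall x, exists P : {poly rat}, iota x = (map_poly ratr P).[z]) /\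
    (forall P : {poly rat}, exists2 x,
       iota x = (map_poly ratr P).[z] & iota (s x) = (map_poly ratr P).[z ^+ g]).
Proof.
move=> p_pr prim_z cop_g; have zp1 := prim_expr_order prim_z.
have zgp1 : (z ^+ g) ^+ p = 1 by rewrite exprAC zp1 expr1n.
have zg1 : z ^+ g != 1.
  rewrite -(prim_order_dvd prim_z); apply: contraL cop_g => dv_pg.
  by rewrite prime_coprime // dv_pg.
pose ev (x : C) (P : {poly rat}) := (map_poly ratr P).[x].
have ev_conj P Q : ev z P = ev z Q -> ev (z ^+ g) P = ev (z ^+ g) Q.
  move/eqP; rewrite -subr_eq0 /ev -hornerN -hornerD -rmorphB => /eqP.
  move/(sum_powers_dvdp p_pr prim_z) => /dvdpP[T PQ].
  apply/eqP; rewrite -subr_eq0 -hornerN -hornerD -rmorphB PQ /= rmorphM hornerM /=.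
  by rewrite root_sum_powers ?mulr0.
pose q : {poly rat} := 'X^p - 1.
have qz0 : root (map_poly (ratr : rat -> C) q) z.
  by rewrite /root rmorphB /= map_polyXn rmorph1 !hornerE zp1 subrr.
have nz_q : q != 0 by rewrite monic_neq0 // monicXnsubC ?prime_gt0.
pose L : fieldType := subFExtend (ratr : {rmorphism rat -> C}) z q.
pose iota : {rmorphism L -> C} := @subfx_inj _ _ (ratr : {rmorphism rat -> C}) z q.
have iotaE P : iota (subfx_eval _ z q P) = ev z P by exact: subfx_inj_eval.
have rep_ex (x : L) : exists P, iota x == ev z P.
  by have [P ->] := subfxE x; exists P; rewrite iotaE.
pose rep x := xchoose (rep_ex x).
have repE x : ev z (rep x) = iota x by rewrite (eqP (xchooseP (rep_ex x))).
pose s (x : L) : L := subfx_eval _ z q (rep x \Po 'X^g).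
have sE x P : iota x = ev z P -> iota (s x) = ev (z ^+ g) P.
  rewrite -repE => /ev_conj <-; rewrite iotaE /ev map_comp_poly horner_comp /=.
  by rewrite map_polyXn hornerXn.
have s_zmod : zmod_morphism s.
  move=> x y; apply: (fmorph_inj iota); rewrite rmorphB /=.
  rewrite (sE _ (rep x - rep y)) ?(sE x (rep x)) ?(sE y (rep y)) ?repE //.
    by rewrite /ev rmorphB hornerD hornerN.
  by rewrite rmorphB /= -!repE /ev rmorphB hornerD hornerN.
have s_monoid : monoid_morphism s.
  split=> [|x y]; apply: (fmorph_inj iota).
    by rewrite (sE _ 1) ?rmorph1 /ev ?rmorph1 ?hornerC.
  rewrite rmorphM /=.
  rewrite (sE _ (rep x * rep y)) ?(sE x (rep x)) ?(sE y (rep y)) ?repE //.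
    by rewrite /ev rmorphM hornerM.
  by rewrite rmorphM /= -!repE /ev rmorphM hornerM.
pose sM : {rmorphism L -> L} := HB.pack s (GRing.isZmodMorphism.Build L L s s_zmod)
  (GRing.isMonoidMorphism.Build L L s s_monoid).
exists L, iota, sM; split=> [x|P]; first by exists (rep x); rewrite -repE.
by exists (subfx_eval _ z q P); [exact: iotaE|apply: sE].
Qed.

(** * Gaussian periods *)

Lemma closed_prim_root_exists (C : numClosedFieldType) p :
  prime p -> exists z : C, p.-primitive_root z.
Proof.
move=> p_pr; pose P : {poly C} := \poly_(i < p) 1.
have PS : P = \sum_(i < p) 'X^i.
  by rewrite [P]poly_def; apply: eq_bigr => i _; rewrite scale1r.
have /closed_rootP[z] : size P != 1%N.
  by rewrite size_poly_eq ?oner_eq0 // gtn_eqF ?prime_gt1.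
rewrite PS /root horner_sum => /eqP sumz0; exists z.
have {}sumz0 : \sum_(i < p) z ^+ i = 0.
  by rewrite -[RHS]sumz0; apply: eq_bigr => i _; rewrite hornerXn.
have zp1 : z ^+ p = 1 by apply/eqP; rewrite -subr_eq0 subrX1 sumz0 mulr0.
have z1 : z != 1.
  apply/eqP=> z1; move/eqP: sumz0.
  rewrite (eq_bigr (fun=> 1)) => [|i _]; last by rewrite z1 expr1n.
  by rewrite sumr_const card_ord pnatr_eq0 -leqn0 leqNgt prime_gt0.
have [k prim_k] := prim_order_exists (prime_gt0 p_pr) zp1.
have /primeP[_ dvp] := p_pr; move/dvp => /pred2P[k1|<- //]; case/negP: z1.
by rewrite -(prim_expr_order prim_k) k1 expr1.
Qed.

(** The period eta_k is the sum of the z^(g^j) over the j congruent to k modulo m,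
    where p is a prime congruent to 1 modulo 2m and g a primitive root modulo p.
    It is real because -1 = g^((p-1)/2), where m divides (p-1)/2, so that complex
    conjugation permutes the terms of eta_k.  The third property is the Moore
    criterion for rational combinations of eta_0, ..., eta_(m-1) and their
    conjugates; the last one says that the norm from the field of the periods to
    the rationals takes integer values on polynomials in the periods with
    integer coefficients. *)
Lemma gaussian_periods (C : numClosedFieldType) m : (0 < m)%N ->
  exists eta : nat -> C,
  [/\ forall k, eta k \is Num.real,
      forall k, eta (k + m)%N = eta k,
      forall r (a : 'M[rat]_(r, m)) t, row_free a ->
        \det (\matrix_(i < r, j < r)
                \sum_(k < m) ratr (a j k) * eta (t + i + k)%N) != 0
    & forall r (c : {ffun 'I_r -> 'I_m} -> int), exists N : int,
        \prod_(t < m) (\sum_f (c f)%:~R * \prod_(i < r) eta (t + i + f i)%N) = N%:~R].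
Proof.
move=> m_gt0.
have [p p_pr /dvdnP[h pE]] : exists2 p, prime p & (2 * m %| p.-1)%N.
  by apply: exists_prime_1mod; rewrite muln_gt0.
have h_gt0 : (0 < h)%N.
  by case: h pE => // pE; have := prime_gt1 p_pr; rewrite -subn_gt0 subn1 pE.
have p_gt2 : (2 < p)%N.
  rewrite -(prednK (prime_gt0 p_pr)) pE ltnS.
  by rewrite (leq_trans _ (leq_pmull _ h_gt0)) // (leq_pmulr 2 m_gt0).
have [g [cop_g gen_g exp_g half_g]] := exists_primitive_root p_pr p_gt2.
have [z prim_z] := closed_prim_root_exists C p_pr.
have zp1 := prim_expr_order prim_z.
have [L [iota [s [evL sL]]]] := cyclotomic_field p_pr prim_z cop_g.
have sE x P : iota x = (map_poly ratr P).[z] ->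
    iota (s x) = (map_poly ratr P).[z ^+ g].
  by have [y <- <-] := sL P => /fmorph_inj ->.
have [t0 t0E _] := sL 'X; rewrite map_polyX hornerX in t0E.
pose theta k := iter k s t0.
have thetaE k : iota (theta k) = z ^+ (g ^ k).
  elim: k => [|k IHk]; first by rewrite expn0.
  by rewrite /= (sE _ 'X^(g ^ k)) ?map_polyXn ?hornerXn // -exprM expnS.
have theta_per k : theta (k + p.-1)%N = theta k.
  apply: (fmorph_inj iota); rewrite !thetaE; apply/eqP.
  by rewrite (eq_prim_root_expr prim_z) exp_g modnDr.
(* m h = (p-1)/2, so the right-hand side is the inverse of theta k. *)
have theta_conj k : (iota (theta k))^* = iota (theta (k + m * h)%N).
  rewrite !thetaE; set w := z ^+ (g ^ k).
  have wp1 : w ^+ p = 1 by rewrite /w exprAC zp1 expr1n.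
  have w1 : `|w| = 1.
    apply/eqP; rewrite -(@pexpr_eq1 _ _ p) ?prime_gt0 //.
    by rewrite -normrX wp1 normr1.
  have nz_w : w != 0 by rewrite -normr_eq0 w1 oner_eq0.
  apply: (mulfI nz_w); rewrite -normCK w1 expr1n expnD exprM -/w.
  have -> : (m * h = (p.-1)./2)%N by rewrite pE mulnCA mul2n doubleK mulnC.
  by rewrite -(expr_mod _ wp1) half_g (expr_mod _ wp1) -exprS prednK ?prime_gt0.
pose eta j := \sum_(l < h * 2) theta (j + m * l)%N.
have s_eta j : s (eta j) = eta j.+1 by rewrite /eta rmorph_sum.
have eta_per j : eta (j + m)%N = eta j.
  rewrite /eta; have: (0 < h * 2)%N by rewrite muln_gt0 h_gt0.
  have: theta (j + m * (h * 2))%N = theta j by rewrite mulnC -mulnA -pE theta_per.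
  case: (h * 2)%N => // H thetaH _; rewrite big_ord_recr [RHS]big_ord_recl /=.
  rewrite muln0 addn0 addrC -addnA -mulnS thetaH; congr (_ + _).
  by apply: eq_bigr => i _; rewrite /bump /= add1n mulnS addnA.
have eta_perM j l : eta (j + m * l)%N = eta j.
  by elim: l => [|l IHl]; rewrite ?muln0 ?addn0 // mulnS addnA addnAC eta_per.
have eta_real j : iota (eta j) \is Num.real.
  rewrite CrealE -[in X in _ == X](eta_perM j h) /eta !rmorph_sum /=.
  by apply/eqP/eq_bigr => l _; rewrite theta_conj addnAC.
have fix_rat x : s x = x -> exists2 q : rat, x = ratr q &
    forall P : {poly rat}, P \is a polyOver Num.int ->
      iota x = (map_poly ratr P).[z] -> q \in Num.int.
  move=> sx; pose Q P := iota x = (map_poly ratr P).[z].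
  have fixP P : Q P -> exists2 q : rat, x = ratr q &
                   P \is a polyOver Num.int -> q \in Num.int.
    rewrite /Q => PE; have := sE _ _ PE; rewrite sx PE => /esym fixP.
    have [q qE qint] := eval_fixed_rat p_pr prim_z cop_g gen_g fixP.
    by exists q => //; apply: (fmorph_inj iota); rewrite PE qE fmorph_rat.
  have [P0 /fixP[q xq _]] := evL x; exists q => // P Pint /fixP[q' xq' /(_ Pint)].
  suff -> : q' = q by [].
  apply: (fmorph_inj (ratr : {rmorphism rat -> C})).
  by rewrite -[LHS](fmorph_rat iota) -[RHS](fmorph_rat iota) -xq -xq'.
have eta_free (q : 'I_m -> rat) : \sum_(j < m) ratr (q j) * iota (eta j) = 0 ->
    forall j, q j = 0.
  move=> rel_q j.
  (* The relation in terms of 1, z, ..., z^(p-1): it does not involve z^0, and the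
     coefficient of z^(g^j) is q j. *)
  pose c (k : 'I_p) : rat :=
    \sum_(jl : 'I_m * 'I_(h * 2) | (g ^ (jl.1 + m * jl.2) %% p == k)%N) q jl.1.
  have c_const : forall k l, c k = c l.
    apply: (cyclotomic_relation p_pr prim_z).
    rewrite -[RHS]rel_q.
    under [RHS]eq_bigr do rewrite /eta rmorph_sum mulr_sumr.
    rewrite [RHS]pair_bigA /=.
    rewrite [RHS](partition_big (fun jl : 'I_m * 'I_(h * 2) =>
       Ordinal (ltn_pmod (g ^ (jl.1 + m * jl.2)) (prime_gt0 p_pr))) xpredT) //=.
    apply: eq_bigr => k _; rewrite /c rmorph_sum mulr_suml.
    apply: eq_big => // jl /eqP <-.
    by rewrite thetaE (expr_mod _ zp1).
  pose k0 : 'I_p := Ordinal (prime_gt0 p_pr).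
  pose kj : 'I_p := Ordinal (ltn_pmod (g ^ j) (prime_gt0 p_pr)).
  have c0 : c k0 = 0.
    rewrite /c big_pred0 // => jl /=; apply/negbTE.
    by rewrite -/(dvdn p _) Euclid_dvdX // negb_and -prime_coprime ?cop_g.
  have hm : (p.-1 = m * (h * 2))%N by rewrite pE mulnA mulnC.
  rewrite -c0 (c_const k0 kj) /c.
  have H_gt0 : (0 < h * 2)%N by rewrite muln_gt0 h_gt0.
  rewrite (big_pred1 (j, Ordinal H_gt0)) //= => -[j' l] /=.
  rewrite exp_g hm !modn_small; first last.
  - rewrite (leq_trans _ (leq_mul (leqnn m) (ltn_ord l))) //.
    by rewrite (mulnS m l) ltn_add2r.
  - by rewrite (leq_trans (ltn_ord j)) // leq_pmulr.
  apply/eqP/eqP=> [jlE|[-> ->]]; last by rewrite muln0 addn0.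
  have j'j : j' = j.
    apply: val_inj; have := congr1 (modn^~ m) jlE.
    by rewrite /= addnC mulnC modnMDl !modn_small.
  move: jlE; rewrite j'j => /eqP; rewrite -[X in _ == X]addn0 eqn_add2l muln_eq0.
  by rewrite gtn_eqF //= => /eqP l0; congr (_, _); apply: val_inj.
exists (iota \o eta); split=> //= [k|r a t free_a|r c].
- by rewrite eta_per.
- pose b j := \sum_(k < m) ratr (a j k) * eta k.
  have free_b (q : 'I_r -> L) : (forall j, s (q j) = q j) ->
      \sum_j q j * b j = 0 -> forall j, q j = 0.
    move=> sq rel_q.
    have [q' q'E] : exists q' : 'I_r -> rat, forall j, q j = ratr (q' j).
      have /(_ _)/sig_eqW q'_ex j : exists q0, q j = ratr q0.
        by have [q0 ->] := fix_rat _ (sq j); exists q0.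
      by exists (fun j => sval (q'_ex j)) => j; case: (q'_ex j).
    have /row_freeP[a' aa'] := free_a.
    pose v := \row_j q' j.
    have va0 : v *m a = 0.
      apply/rowP=> k; rewrite !mxE.
      apply: (eta_free (fun k => \sum_j v 0 j * a j k)) => {k}.
      rewrite -[RHS](rmorph0 iota) -rel_q rmorph_sum /=.
      under [RHS]eq_bigr do rewrite rmorphM q'E fmorph_rat /b rmorph_sum mulr_sumr.
      rewrite [RHS]exchange_big; apply: eq_bigr => k _ /=.
      rewrite rmorph_sum mulr_suml; apply: eq_bigr => j _.
      by rewrite !mxE rmorphM -mulrA (rmorphM iota) (fmorph_rat iota).
    move=> j; have : v *m a *m a' = v by rewrite -mulmxA aa' mulmx1.
    rewrite va0 mul0mx => /rowP/(_ j); rewrite !mxE q'E => <-.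
    by apply: (fmorph_inj iota); rewrite fmorph_rat !rmorph0.
  have iter_sum (q : 'I_r -> L) : (forall j, s (q j) = q j) ->
      \sum_j q j * iter t s (b j) = iter t s (\sum_j q j * b j).
    move=> sq; elim: t => //= t <-; rewrite rmorph_sum.
    by apply: eq_bigr => j _; rewrite rmorphM sq.
  have free_bt (q : 'I_r -> L) : (forall j, s (q j) = q j) ->
      \sum_j q j * iter t s (b j) = 0 -> forall j, q j = 0.
    move=> sq; rewrite iter_sum // => rel_q; apply: free_b => //.
    by elim: t rel_q {iter_sum} => //= t IHt /eqP; rewrite fmorph_eq0 => /eqP.
  have := moore_det_neq0 free_bt; rewrite -(fmorph_eq0 iota) -det_map_mx.
  congr (\det _ != 0); apply/matrixP=> i j; rewrite !mxE -iterD addnC.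
  have -> : iter (t + i) s (b j) = \sum_(k < m) ratr (a j k) * eta (t + i + k)%N.
    elim: (t + i)%N => //= l ->; rewrite rmorph_sum; apply: eq_bigr => k _.
    by rewrite rmorphM fmorph_rat s_eta.
  by rewrite rmorph_sum; apply: eq_bigr => k _; rewrite rmorphM fmorph_rat.
pose delta t := \sum_f (c f)%:~R * \prod_(i < r) eta (t + i + f i)%N.
have s_delta t : s (delta t) = delta t.+1.
  rewrite rmorph_sum; apply: eq_bigr => f _; rewrite rmorphM rmorph_int rmorph_prod.
  by congr (_ * _); apply: eq_bigr => i _; rewrite s_eta.
have delta_per : delta m = delta 0%N.
  apply: eq_bigr => f _; congr (_ * _); apply: eq_bigr => i _.
  by rewrite add0n -addnA addnC eta_per.
have [|q qE qint] := fix_rat (\prod_(t < m) delta t).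
  rewrite rmorph_prod; under eq_bigr do rewrite s_delta.
  case: (m) m_gt0 delta_per => // m' _ delta_per.
  by rewrite big_ord_recr [RHS]big_ord_recl /= mulrC delta_per.
pose integral x := exists2 P : {poly rat}, forall i, P`_i \in Num.int &
                                          iota x = (map_poly ratr P).[z].
have int_int (k : int) : integral k%:~R.
  exists (k%:~R)%:P; first by move=> i; rewrite coefC; case: eqP; rewrite ?intr_int ?rpred0.
  by rewrite map_polyC hornerC /= !rmorph_int.
have int0 : integral 0 := int_int 0.
have int1 : integral 1 := int_int 1.
have intM x y : integral x -> integral y -> integral (x * y).
  move=> [P Pint xP] [Q Qint yQ]; exists (P * Q).
    by move=> i; rewrite coefM rpred_sum // => j _; rewrite rpredM.
  by rewrite !rmorphM hornerM xP yQ.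
have intD x y : integral x -> integral y -> integral (x + y).
  move=> [P Pint xP] [Q Qint yQ]; exists (P + Q); first by move=> i; rewrite coefD rpredD.
  by rewrite !rmorphD hornerD xP yQ.
have int_theta k : integral (theta k).
  exists ('X^(g ^ k)); first by move=> i; rewrite coefXn natr_int.
  by rewrite map_polyXn hornerXn thetaE.
have int_delta t : integral (delta t).
  apply: (big_ind integral int0 intD) => f _; apply: (intM _ _); first exact: int_int.
  apply: (big_ind integral int1 intM) => i _.
  by apply: (big_ind integral int0 intD) => l _.
have [P Pint PE] : integral (\prod_(t < m) delta t).
  by apply: (big_ind integral int1 intM).
have /intrP[N NE] := qint P (introT polyOverP Pint) PE; exists N.
have -> : N%:~R = iota (ratr q) by rewrite fmorph_rat NE ratr_int.
rewrite -qE rmorph_prod; apply: eq_bigr => t _.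
rewrite /delta rmorph_sum; apply: eq_bigr => f _.
by rewrite rmorphM rmorph_int rmorph_prod.
Qed.

Lemma real_gaussian_periods (R : rcfType) m : (0 < m)%N ->
  exists eta : nat -> R,
  [/\ forall k, eta (k + m)%N = eta k,
      forall r (a : 'M[rat]_(r, m)) t, row_free a ->
        \det (\matrix_(i < r, j < r)
                \sum_(k < m) ratr (a j k) * eta (t + i + k)%N) != 0
    & forall r (c : {ffun 'I_r -> 'I_m} -> int), exists N : int,
        \prod_(t < m) (\sum_f (c f)%:~R * \prod_(i < r) eta (t + i + f i)%N) = N%:~R].
Proof.
move=> m_gt0; have [eta [eta_real eta_per moore norm]] := gaussian_periods R[i] m_gt0.
pose eta' k := complex.Re (eta k).
have etaE k : real_complex R (eta' k) = eta k by rewrite /eta' RRe_real.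
exists eta'; split=> [k|r a t free_a|r c].
- by rewrite /eta' eta_per.
- have := moore r a t free_a; rewrite -(fmorph_eq0 (real_complex R)) -det_map_mx.
  congr (\det _ != 0); apply/matrixP=> i j; rewrite !mxE rmorph_sum.
  by apply: eq_bigr => k _; rewrite rmorphM /= etaE (fmorph_rat (real_complex R)).
have [N NE] := norm r c; exists N; apply: (fmorph_inj (real_complex R)).
rewrite rmorph_int -NE rmorph_prod; apply: eq_bigr => t _.
rewrite rmorph_sum; apply: eq_bigr => f _; rewrite rmorphM rmorph_int rmorph_prod.
by congr (_ * _); apply: eq_bigr => i _; rewrite /= etaE.
Qed.

(** * Minors *)

(** The Cauchy-Binet formula before the terms with the same image are collected:
    the sum ranges over all maps, and no ordering of the indices is needed. *)
Lemma cauchy_binet_ffun (R : comNzRingType) d n (A : 'M[R]_(d, n)) (B : 'M[R]_(n, d)) :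
  \det (A *m B) =
  \sum_(f : {ffun 'I_d -> 'I_n}) (\prod_i A i (f i)) * \det (rowsub f B).
Proof.
rewrite /determinant; under [RHS]eq_bigr do rewrite mulr_sumr.
rewrite exchange_big /=; apply: eq_bigr => s _.
under [in LHS]eq_bigr do rewrite mxE.
rewrite bigA_distr_bigA /= mulr_sumr; apply: eq_bigr => f _.
rewrite big_split /= mulrCA; congr (_ * (_ * _)).
by apply: eq_bigr => i _; rewrite mxE.
Qed.

Lemma exists_sorting_perm d n (f : 'I_d -> 'I_n) : injective f ->
  exists s : 'S_d, forall i j : 'I_d, (i < j)%N -> (f (s i) < f (s j))%N.
Proof.
move=> f_inj; pose t := [tuple f i | i < d].
pose le (a b : 'I_n) := (a <= b)%N.
have le_total : total le by move=> a b; apply: leq_total.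
have le_trans : transitive le by move=> a b c; apply: leq_trans.
have /tuple_permP[s sE] : perm_eq (sort le t) t by rewrite perm_sort.
have lt_sorted : sorted (fun a b : 'I_n => (a < b)%N) (sort le t).
  have := sort_sorted le_total t.
  have : uniq (sort le t) by rewrite sort_uniq map_inj_uniq ?enum_uniq.
  elim: (sort le t) => // a l IHl; case: l IHl => // b l IHl.
  move=> /= /andP[]; rewrite in_cons negb_or => /andP[nab _] ub /andP[ab sb].
  by apply/andP; split; [rewrite ltn_neqAle; apply/andP|apply: IHl].
exists s => i j ij.
have nthE (k : 'I_d) : nth (f i) (sort le t) k = f (s k).
  rewrite sE (nth_map k) ?size_enum_ord // nth_ord_enum.
  by rewrite tnth_mktuple.
rewrite -!nthE; apply: (sorted_ltn_nth _ _ lt_sorted) => //.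
- by move=> a b c; apply: ltn_trans.
- by rewrite inE size_sort size_tuple.
by rewrite inE size_sort size_tuple.
Qed.

(** A repeated row makes the minor vanish; otherwise a permutation sorts the rows.
    So the minors with increasing row indices determine all the others. *)
Lemma det_rowsub_sort (R : comNzRingType) d n (M : 'M[R]_(n, d)) (f : 'I_d -> 'I_n) :
  (\det (rowsub f M) = 0) \/
  exists (g : {ffun 'I_d -> 'I_n}) (b : bool),
    (forall i j : 'I_d, (i < j)%N -> (g i < g j)%N) /\
    \det (rowsub f M) = (-1) ^+ b * \det (rowsub g M).
Proof.
have [/injectiveP f_inj|/injectivePn[i [j nij fij]]] := boolP (injectiveb f); last first.
  by left; apply: (determinant_alternate nij) => k; rewrite !mxE fij.
right; have [s s_mono] := exists_sorting_perm f_inj.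
exists [ffun i => f (s i)], (odd_perm s); split=> [i j ij|].
  by rewrite !ffunE s_mono.
have -> : rowsub [ffun i => f (s i)] M = row_perm s (rowsub f M).
  by apply/matrixP=> i j; rewrite !mxE ffunE.
by rewrite row_permE det_mulmx det_perm mulrA -signr_addb addbb mul1r.
Qed.

(** Expand along row j: the cofactors of that row are those of the identity. *)
Lemma det_replaced_row (R : comNzRingType) d (X : 'M[R]_d) j :
  (forall i, i != j -> row i X = row i 1%:M) -> \det X = X j j.
Proof.
move=> XE; rewrite (expand_det_row _ j).
have cofE l : cofactor X j l = (l == j)%:R.
  have -> : cofactor X j l = (\adj 1%:M) l j.
    rewrite mxE /cofactor; congr (_ * \det _); apply/matrixP=> a b; rewrite !mxE.
    have /rowP/(_ (lift l b)) := XE (lift j a) (negbT (lift_eqF _ _)).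
    by rewrite !mxE.
  have := mul_mx_adj (1%:M : 'M[R]_d); rewrite mul1mx det1 => ->.
  by rewrite mxE.
rewrite (bigD1 j) //= cofE eqxx mulr1 big1 ?addr0 // => l /negPf nlj.
by rewrite cofE nlj mulr0.
Qed.

(** * Folding a space onto a coordinate subspace *)

Lemma dim_sum_lines_ord (F : fieldType) (vT : vectType F) n q (v : 'I_n -> vT) :
  (\dim (\sum_(k < n | (q <= k)%N) <[v k]>) <= n - q)%N.
Proof.
apply: leq_trans (dimv_leq_sum _ _ _) _.
apply: (@leq_trans (\sum_(k : 'I_n | (q <= k)%N) 1)%N).
  by apply: leq_sum => k _; rewrite dim_vline leq_b1.
by rewrite -(big_geq_mkord q n xpredT (fun=> 1%N)) sum_nat_const_nat muln1.
Qed.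

(** T is the 0-1 matrix of a linear map that is the identity on the first m
    coordinates and sends each e_k, k >= m, to some e_j, j < m, or to 0.  Its
    kernel is spanned by the vectors e_k - base (u k), which are chosen one after
    the other outside the sum of B and of the previous ones.  This is possible:
    if e_k and all the e_k - e_j were in that sum, then so would be
    e_0, ..., e_k, more vectors than the dimension dim B + (k - m) <= k allows. *)
Lemma exists_injective_folding (F : fieldType) n m (B : {vspace 'rV[F]_n}) :
    (\dim B <= m)%N -> (m <= n)%N ->
  exists T : 'I_m -> 'I_n -> bool,
    (forall j (k : 'I_n), (k < m)%N -> T j k = (j == k :> nat)) /\
    (forall y, y \in B -> (forall j, \sum_k (T j k)%:R * y 0 k = 0) -> y = 0).
Proof.
move=> dimB le_mn; pose e (k : 'I_n) : 'rV[F]_n := delta_mx 0 k.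
pose base (v : option 'I_m) := if v is Some j then e (widen_ord le_mn j) else 0.
pose w (u : 'I_n -> option 'I_m) k := e k - base (u k).
pose W u s := (\sum_(k : 'I_n | (m <= k)%N && (k < m + s)%N) <[w u k]>)%VS.
suff /(_ (n - m)%N (leqnn _))[u [_ uB]] : forall s, (s <= n - m)%N ->
    exists u, (\dim (W u s) <= s)%N /\ forall x, x \in B -> x \in W u s -> x = 0.
  pose T (j : 'I_m) (k : 'I_n) :=
    if (k < m)%N then j == k :> nat else u k == Some j.
  exists T; split=> [j k|y yB Ty]; first by rewrite /T => ->.
  apply: uB => //; suff -> : y = \sum_(k : 'I_n | (m <= k)%N && (k < m + (n - m))%N) y 0 k *: w u k.
    by apply: memv_sumr => k _; rewrite memvZ ?memv_line.
  apply/rowP=> l; rewrite summxE.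
  rewrite (eq_bigl (fun k : 'I_n => (m <= k)%N)); last first.
    by move=> k; rewrite subnKC // ltn_ord andbT.
  have wE k : w u k 0 l = (l == k)%:R - (if u k is Some j then l == j :> nat else false)%:R.
    rewrite !mxE; case: (u k) => [j|]; rewrite mxE //=.
  have [lt_lm|le_ml] := ltnP l m.
    have := Ty (Ordinal lt_lm); rewrite (bigD1 l) //= {1}/T lt_lm eqxx mul1r.
    rewrite (bigID (fun k : 'I_n => (m <= k)%N)) /= [X in _ + (_ + X)]big1 ?addr0; last first.
      move=> k /andP[nkl]; rewrite -ltnNge /T => ->.
      by rewrite eq_sym (inj_eq val_inj) (negPf nkl) mul0r.
    move/eqP; rewrite addr_eq0 => /eqP ->; rewrite -sumrN.
    apply: eq_big => [k|k le_mk].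
      rewrite andbC; case: leqP => //= le_mk.
      by rewrite -(inj_eq val_inj) gtn_eqF // (leq_trans lt_lm).
    have le_mk' : (m <= k)%N by case/andP: le_mk.
    rewrite mxE wE -(inj_eq val_inj) /= ltn_eqF ?(leq_trans lt_lm) // sub0r mulrN.
    rewrite /T ltnNge le_mk' /= mulrC; congr (- (_ * _%:R)).
    case: (u k) => //= j; congr nat_of_bool; apply/eqP/eqP => [[->] //|lj].
    by congr Some; apply: val_inj.
  rewrite (bigD1 l) //= big1 ?addr0 => [|k /andP[_ nkl]].
    rewrite mxE wE eqxx; case: (u l) => [j|]; rewrite ?subr0 ?mulr1 //.
    by rewrite gtn_eqF ?subr0 ?mulr1 // (leq_trans _ le_ml).
  rewrite mxE wE eq_sym (negPf nkl); case: (u k) => [j|]; rewrite ?subr0 ?mulr0 //.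
  by rewrite gtn_eqF ?subr0 ?mulr0 // (leq_trans _ le_ml).
elim=> [|s IHs] le_s.
  exists (fun=> None); rewrite /W big_pred0 ?dimv0; last first.
    by move=> k; rewrite addn0 ltnNge andbN.
  by split=> // x _; rewrite memv0 => /eqP.
have [u [dimW uB]] := IHs (ltnW le_s).
have lt_ms : (m + s < n)%N by rewrite -ltn_subRL.
pose k0 := Ordinal lt_ms.
have [v o_out] : exists v, e k0 - base v \notin (B + W u s)%VS.
  apply/existsP; rewrite -[[exists _, _]]negbK negb_exists; apply/negP=> /forallP in_BW.
  have {}in_BW v : e k0 - base v \in (B + W u s)%VS by rewrite -[_ \in _]negbK.
  have e0 : e k0 \in (B + W u s)%VS by have := in_BW None; rewrite /= subr0.
  have e_base v : base v \in (B + W u s)%VS.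
    by rewrite -[base v](subKr (e k0)) memvB.
  have e_in (k : 'I_n) : (k <= k0)%N -> e k \in (B + W u s)%VS.
    rewrite leq_eqVlt => /orP[/eqP/val_inj->//|lt_k].
    have [lt_km|le_mk] := ltnP k m.
      suff -> : e k = base (Some (Ordinal lt_km)) by apply: e_base.
      by congr e; apply: val_inj.
    rewrite -[e k](subrK (base (u k))) memvD //.
    apply: (subvP (addvSr _ _)); rewrite /W (bigD1 k) ?le_mk //=.
    by apply: (subvP (addvSl _ _)); apply: memv_line.
  (* With the remaining vectors e_k this gives the whole space, one dimension more
     than the bounds allow. *)
  have full : (fullv <= B + W u s + \sum_(k : 'I_n | (m + s < k)%N) <[e k]>)%VS.
    apply/subvP=> x _; rewrite [x]row_sum_delta; apply: memv_suml => k _.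
    rewrite memvZ //; have [le_k|lt_k] := leqP k k0.
      by apply: (subvP (addvSl _ _)); apply: e_in.
    apply: (subvP (addvSr _ _)); rewrite (bigD1 k) //=.
    by apply: (subvP (addvSl _ _)); apply: memv_line.
  have := dimvS full; rewrite dimvf /dim /= mul1n leqNgt => /negP; apply.
  apply: leq_ltn_trans (dimv_add_leqif _ _) _.
  apply: (@leq_ltn_trans ((m + s) + (n - (m + s).+1))).
    apply: leq_add; last exact: dim_sum_lines_ord.
    by apply: leq_trans (dimv_add_leqif _ _) _; apply: leq_add.
  by rewrite -ltn_subRL ltn_sub2l.
pose u' k := if k == k0 then v else u k.
have W' : W u' s.+1 = (W u s + <[e k0 - base v]>)%VS.
  rewrite /W (bigD1 k0) ?leq_addr ?addnS ?ltnS //= addvC; congr (_ + _)%VS.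
    apply: eq_big => [k|k /andP[_ nk]]; last by rewrite /w /u' (negPf nk).
    by rewrite -andbA; congr (_ && _); rewrite ltnS [RHS]ltn_neqAle andbC.
  by rewrite /w /u' eqxx.
exists u'; rewrite W'; split.
  apply: leq_trans (dimv_add_leqif _ _) _; rewrite -(addn1 s).
  by apply: leq_add => //; rewrite dim_vline leq_b1.
move=> x xB /memv_addP[x1 x1W [x2 /vlineP[a ->] xE]].
have [a0|nz_a] := eqVneq a 0.
  by move: xE; rewrite a0 scale0r addr0 => xx1; apply: uB; rewrite // xx1.
case/negP: o_out; rewrite -[_ - _]scale1r -(mulVf nz_a) -scalerA memvZ //.
have -> : a *: (e k0 - base v) = x - x1 by rewrite xE [RHS]addrC addKr.
by apply: memvB; [apply: (subvP (addvSl _ _))|apply: (subvP (addvSr _ _))].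
Qed.

(** * Determinants of conjugate linear forms *)

Lemma norm_det_le (R : realFieldType) d (G : 'M[R]_d) (K : R) :
  (forall i j, `|G i j| <= K) -> `|\det G| <= d`!%:R * K ^+ d.
Proof.
move=> GK; apply: le_trans (ler_norm_sum _ _ _) _.
apply: (@le_trans _ _ (\sum_(s : 'S_d) K ^+ d)).
  apply: ler_sum => s _; rewrite normrM normr_sign mul1r normr_prod.
  rewrite -[in leRHS](card_ord d) -prodr_const; apply: ler_prod => i _.
  by rewrite normr_ge0 GK.
by rewrite sumr_const card_Sn -[leLHS]mulr_natl.
Qed.

Lemma norm_adj_le (R : realFieldType) d (G : 'M[R]_d) (K : R) :
  (forall i j, `|G i j| <= K) ->
  forall i j, `|(\adj G) i j| <= d.-1`!%:R * K ^+ d.-1.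
Proof.
move=> GK i j; rewrite mxE /cofactor normrM normrX normrN1 expr1n mul1r.
by apply: norm_det_le => a b; rewrite !mxE.
Qed.

(** Cramer's rule: the coordinates of the basis of the column space of M that
    restricts to the identity on the rows f0 are quotients of minors.  They are
    at most 1 in absolute value when the minor of f0 is the largest one. *)
Lemma mulmx_inv_rowsub (F : fieldType) n d (M : 'M[F]_(n, d)) (f0 : 'I_d -> 'I_n) :
    \det (rowsub f0 M) != 0 ->
  forall k j, (M *m invmx (rowsub f0 M)) k j =
    \det (rowsub [ffun i => if i == j then k else f0 i] M) / \det (rowsub f0 M).
Proof.
move=> nz0 k j; set V := M *m _; set f := [ffun i => _].
have unit0 : rowsub f0 M \in unitmx by rewrite unitmxE unitfE.
have subV (g : 'I_d -> 'I_n) : rowsub g V = rowsub g M *m invmx (rowsub f0 M).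
  by rewrite /V; apply/matrixP=> a b; rewrite !mxE; apply: eq_bigr => l _; rewrite !mxE.
have <- : \det (rowsub f V) = V k j.
  rewrite (@det_replaced_row _ _ _ j) => [|i nij]; first by rewrite mxE ffunE eqxx.
  apply/rowP=> l; rewrite !mxE ffunE (negPf nij).
  have := mulmxV unit0; rewrite -subV => /matrixP/(_ i l).
  by rewrite !mxE.
by rewrite subV det_mulmx det_inv.
Qed.

Definition hankel_mx (R : realFieldType) (eta : nat -> R) d m t : 'M[R]_(d, m) :=
  \matrix_(i, k) eta (t + i + k)%N.

Definition fold_mx (R : pzSemiRingType) m n (T : 'I_m -> 'I_n -> bool) : 'M[R]_(m, n) :=
  \matrix_(j, k) (T j k)%:R.

Lemma periodic_bounded (R : realFieldType) (eta : nat -> R) m : (0 < m)%N ->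
    (forall k, eta (k + m)%N = eta k) ->
  exists2 K : R, 0 <= K & forall k, `|eta k| <= K.
Proof.
move=> m_gt0 per; exists (\sum_(k < m) `|eta k|) => [|k].
  by apply: sumr_ge0.
have -> : eta k = eta (k %% m)%N.
  rewrite [in LHS](divn_eq k m) addnC; elim: (k %/ m)%N => [|q IHq].
    by rewrite mul0n addn0.
  by rewrite mulSnr addnA per.
rewrite (bigD1 (Ordinal (ltn_pmod k m_gt0))) //= lerDl.
by apply: sumr_ge0.
Qed.

(** The columns of M are a basis of a subspace with integer Pluecker coordinates z,
    bounded by H, and T folds the subspace injectively.  The matrix E t holds the
    coefficients of the d folded forms L_t, ..., L_(t+d-1), and
    D t = c det (E t M).  The conclusion bounds from below the values e of
    L_0, ..., L_(d-1) at a vector M v of the subspace that is not small.  Up to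
    constants, 1 <= |D 0| ... |D (m-1)| and |D t| <= H, while D 0 = z f0 det G,
    where G is the matrix of these forms on the reduced basis V; as adj(G) G is
    det G times the identity, |det G| <= e. *)
Lemma hankel_lower_bound (R : realFieldType) n d m (eta : nat -> R) :
    (0 < m)%N -> (forall k, eta (k + m)%N = eta k) ->
    (forall c : {ffun 'I_d -> 'I_m} -> int, exists N : int,
        \prod_(t < m) (\sum_f (c f)%:~R * \prod_(i < d) eta (t + i + f i)%N) = N%:~R) ->
  exists2 c0 : R, 0 < c0 &
  forall (T : 'I_m -> 'I_n -> bool) (M : 'M[R]_(n, d)) (c H : R)
         (z : {ffun 'I_d -> 'I_n} -> int),
    (forall f, (z f)%:~R = c * \det (rowsub f M)) ->
    (exists f, z f != 0) ->
    (forall f, `|(z f)%:~R| <= H) ->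
    (forall t (v : 'cV_d), hankel_mx eta d m t *m fold_mx R T *m M *m v = 0 -> v = 0) ->
  forall (v : 'cV_d) (k : 'I_n) (e : R),
    n%:R^-1 <= `|(M *m v) k 0| ->
    (forall i, `|(hankel_mx eta d m 0 *m fold_mx R T *m M *m v) i 0| <= e) ->
  c0 <= e * H ^+ m.
Proof.
move=> m_gt0 eta_per eta_norm.
have [K K_ge0 eta_le] := periodic_bounded m_gt0 eta_per.
pose K1 := m%:R * K; pose C1 := (n ^ d)%:R * K1 ^+ d.
pose K3 := d.-1`!%:R * (n%:R * K1) ^+ d.-1.
pose Q := n%:R * (d%:R * (d%:R * K3)) * C1 ^+ m.-1.
have K1_ge0 : 0 <= K1 by apply: mulr_ge0.
have C1_ge0 : 0 <= C1 by apply: mulr_ge0; rewrite ?exprn_ge0.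
have K3_ge0 : 0 <= K3.
  by apply: mulr_ge0 => //; apply/exprn_ge0/mulr_ge0.
have Q_ge0 : 0 <= Q.
  by apply: mulr_ge0; [do 3!apply: mulr_ge0 => //|apply: exprn_ge0].
(* The summand 1 makes the constant positive for every choice of parameters. *)
exists (Q + 1)^-1; first by rewrite invr_gt0 ltr_wpDl.
move=> T M c H z zE [f1 nz_zf1] zH nondeg v k e vk e_le.
pose E t := hankel_mx eta d m t *m fold_mx R T.
have H_ge0 : 0 <= H by apply: le_trans (zH f1).
have e_ge0 : 0 <= e.
  have [d0|d_gt0] := posnP d; last exact: le_trans (e_le (Ordinal d_gt0)).
  move: vk; rewrite mxE big1 => [|i _]; last by have := ltn_ord i; rewrite {2}d0.
  by rewrite normr0 invr_le0 lern0; case: (n) k => [[]|].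
have nz_c : c != 0.
  by apply: contraNneq nz_zf1 => c0; rewrite -(intr_eq0 R) zE c0 mul0r.
have E_le t i l : `|E t i l| <= K1.
  rewrite mxE; apply: le_trans (ler_norm_sum _ _ _) _.
  apply: (@le_trans _ _ (\sum_(j < m) K)); last by rewrite sumr_const card_ord -[leLHS]mulr_natl.
  apply: ler_sum => j _; rewrite !mxE normrM normr_nat.
  by case: (T j l); rewrite ?mulr1 ?mulr0.
pose D t := c * \det (E t *m M).
have nz_det t : \det (E t *m M) != 0.
  apply/negP; rewrite -det_tr => /det0P[w nz_w wE].
  case/negP: nz_w; apply/eqP/trmx_inj; rewrite trmx0; apply: (nondeg t).
  by apply: trmx_inj; rewrite trmx0 trmx_mul trmxK.
have nz_D t : D t != 0 by rewrite mulf_neq0.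
have DE t : D t = \sum_(f : {ffun 'I_d -> 'I_n}) (\prod_i E t i (f i)) * (z f)%:~R.
  rewrite /D cauchy_binet_ffun mulr_sumr; apply: eq_bigr => f _.
  by rewrite zE mulrCA.
have D_le t : `|D t| <= C1 * H.
  rewrite DE; apply: le_trans (ler_norm_sum _ _ _) _.
  apply: (@le_trans _ _ (\sum_(f : {ffun 'I_d -> 'I_n}) K1 ^+ d * H)).
    apply: ler_sum => f _; rewrite normrM ler_pM // normr_prod.
    rewrite -[in leRHS](card_ord d) -prodr_const; apply: ler_prod => i _.
    by rewrite normr_ge0 E_le.
  by rewrite sumr_const card_ffun !card_ord -[leLHS]mulr_natl mulrA.
have prod_ge1 : 1 <= \prod_(t < m) `|D t|.
  (* The Pluecker coordinates of the folded subspace: they are integers, and D t is a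
     polynomial in the periods of the kind that the norm condition is about. *)
  pose z' (g : {ffun 'I_d -> 'I_m}) : int :=
    \sum_(f : {ffun 'I_d -> 'I_n}) (\prod_i (T (g i) (f i))%:R) * z f.
  have [N NE] := eta_norm z'.
  have DE' t : D t = \sum_(g : {ffun 'I_d -> 'I_m})
      (z' g)%:~R * \prod_(i < d) eta (t + i + g i)%N.
    rewrite /D /E -mulmxA cauchy_binet_ffun mulr_sumr; apply: eq_bigr => g _.
    rewrite mulrCA mulrC; congr (_ * _); last by apply: eq_bigr => i _; rewrite mxE.
    have -> : rowsub g (fold_mx R T *m M) = rowsub g (fold_mx R T) *m M.
      by apply/matrixP=> a b; rewrite !mxE; apply: eq_bigr => l _; rewrite !mxE.
    rewrite cauchy_binet_ffun mulr_sumr /z' rmorph_sum; apply: eq_bigr => f _.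
    rewrite rmorphM /= zE mulrCA rmorph_prod; congr (_ * _).
    by apply: eq_bigr => i _; rewrite !mxE /= rmorph_nat.
  have {}NE : \prod_(t < m) D t = N%:~R.
    by rewrite -NE; apply: eq_bigr => t _.
  have nz_N : N != 0.
    rewrite -(intr_eq0 R) -NE; apply/prodf_neq0 => t _; exact: nz_D.
  by rewrite -normr_prod NE -intr_norm (ler_int _ 1) -gtz0_ge1 normr_gt0.
(* The largest minor gives a basis V of the column space with entries at most 1. *)
pose f0 := [arg max_(f > f1) `|z f|%R]%O.
have [nz_zf0 z_max] : z f0 != 0 /\ forall f, `|z f| <= `|z f0|.
  rewrite /f0; case: arg_maxP => //= f _ f_max; split=> [|g]; last exact: f_max.
  by rewrite -normr_gt0; apply: lt_le_trans (f_max f1 isT); rewrite normr_gt0.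
have nz_f0 : \det (rowsub f0 M) != 0.
  by apply: contraNneq nz_zf0 => d0; rewrite -(intr_eq0 R) zE d0 mulr0.
have unit0 : rowsub f0 M \in unitmx by rewrite unitmxE unitfE.
set V := M *m invmx (rowsub f0 M).
have V_le1 : forall k j, `|V k j| <= 1.
  move=> l j; rewrite mulmx_inv_rowsub // normrM normfV ler_pdivrMr ?normr_gt0 //.
  rewrite mul1r -(ler_pM2l (_ : 0 < `|c|)) ?normr_gt0 //.
  by rewrite -!normrM -!zE -!intr_norm ler_int.
have ME : M = V *m rowsub f0 M by rewrite mulmxKV.
pose u := rowsub f0 M *m v.
pose G := E 0%N *m V.
have G_le i j : `|G i j| <= n%:R * K1.
  rewrite mxE; apply: le_trans (ler_norm_sum _ _ _) _.
  apply: (@le_trans _ _ (\sum_(l < n) K1)); last by rewrite sumr_const card_ord -[leLHS]mulr_natl.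
  by apply: ler_sum => l _; rewrite normrM -[leRHS]mulr1 ler_pM.
have detG_u j : `|\det G| * `|u j 0| <= d%:R * K3 * e.
  have -> : `|\det G| * `|u j 0| = `|(\adj G *m (G *m u)) j 0|.
    by move: (u) => w; rewrite mulmxA mul_adj_mx mul_scalar_mx mxE normrM.
  rewrite mxE; apply: le_trans (ler_norm_sum _ _ _) _.
  apply: (@le_trans _ _ (\sum_(l < d) K3 * e)); last first.
    by rewrite sumr_const card_ord -[leLHS]mulr_natl mulrA.
  apply: ler_sum => l _; rewrite normrM ler_pM //; first exact: norm_adj_le.
  by have := e_le l; rewrite /G /u mulmxA -(mulmxA _ V) -ME.
have detG_le : `|\det G| <= n%:R * (d%:R * (d%:R * K3)) * e.
  have n_gt0 : 0 < n%:R :> R by rewrite ltr0n; case: (n) k {vk} => [[]|].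
  rewrite -mulrA -ler_pdivrMl // mulrC.
  apply: le_trans (ler_wpM2l (normr_ge0 _) vk) _.
  rewrite {1}ME -mulmxA -/u mxE.
  apply: le_trans (ler_wpM2l (normr_ge0 _) (ler_norm_sum _ _ _)) _.
  rewrite mulr_sumr; apply: (@le_trans _ _ (\sum_(j < d) d%:R * K3 * e)).
    apply: ler_sum => j _; apply: le_trans (detG_u j).
    by rewrite normrM ler_wpM2l // -[leRHS]mul1r ler_wpM2r.
  by rewrite sumr_const card_ord -[leLHS]mulr_natl !mulrA.
have D0E : `|D 0%N| = `|\det G| * `|(z f0)%:~R|.
  by rewrite /D {1}ME mulmxA det_mulmx -/G zE -normrM mulrCA.
have step : 1 <= Q * (e * H ^+ m).
  apply: le_trans prod_ge1 _; rewrite -(prednK m_gt0) big_ord_recl /= D0E.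
  apply: (@le_trans _ _ (n%:R * (d%:R * (d%:R * K3)) * e * H * (C1 * H) ^+ m.-1)).
    apply: ler_pM; [exact: mulr_ge0|exact: prodr_ge0|exact: ler_pM|].
    rewrite -[X in _ ^+ X](card_ord m.-1) -prodr_const; apply: ler_prod => t _.
    by rewrite normr_ge0 D_le.
  by rewrite exprMn exprS /Q (_ : _ * _ = Q * (e * (H * H ^+ m.-1))) // /Q; ring.
rewrite -div1r ler_pdivrMr ?ltr_wpDl //.
apply: le_trans step _; rewrite mulrDr mulr1 mulrC lerDl.
by rewrite mulr_ge0 ?exprn_ge0.
Qed.

(** * Angles between subspaces *)

Lemma normv_sqr (R : realType) n (x : 'rV[R]_n) : normv x ^+ 2 = \sum_i x 0 i ^+ 2.
Proof. by rewrite sqr_sqrtr // sumr_ge0 // => i _; apply: sqr_ge0. Qed.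

Lemma normv_ge0 (R : realType) n (x : 'rV[R]_n) : 0 <= normv x.
Proof. exact: sqrtr_ge0. Qed.

Lemma normv_gt0 (R : realType) n (x : 'rV[R]_n) : (0 < normv x) = (x != 0).
Proof.
rewrite lt_def normv_ge0 andbT; congr (~~ _).
apply/eqP/eqP=> [x0|->]; last first.
  by apply/eqP; rewrite -sqrf_eq0 normv_sqr big1 // => i _; rewrite mxE expr0n.
apply/rowP=> i; rewrite mxE; apply/eqP; rewrite -sqrf_eq0; apply/eqP.
have /psumr_eq0P : \sum_i x 0 i ^+ 2 = 0 by rewrite -normv_sqr x0 expr0n.
by apply=> // j _; apply: sqr_ge0.
Qed.

Lemma normvZ (R : realType) n (a : R) (x : 'rV[R]_n) : normv (a *: x) = `|a| * normv x.
Proof.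
rewrite /normv /l2norm -sqrtr_sqr -sqrtrM ?sqr_ge0 // mulr_sumr; congr Num.sqrt.
by apply: eq_bigr => i _; rewrite mxE exprMn.
Qed.

Lemma norm_wedgeZ (R : realType) n (a b : R) (x y : 'rV[R]_n) :
  norm_wedge (a *: x) (b *: y) = `|a * b| * norm_wedge x y.
Proof.
rewrite /norm_wedge /l2norm -sqrtr_sqr -sqrtrM ?sqr_ge0 // mulr_sumr; congr Num.sqrt.
by apply: eq_bigr => i _; rewrite !mxE; ring.
Qed.

Lemma sin_angle_normalize (R : realType) n (x y : 'rV[R]_n) : x != 0 -> y != 0 ->
  sin_angle ((normv x)^-1 *: x) ((normv y)^-1 *: y) = sin_angle x y.
Proof.
rewrite -!normv_gt0 => x_gt0 y_gt0; rewrite /sin_angle norm_wedgeZ !normvZ.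
rewrite !ger0_norm ?mulr_ge0 ?invr_ge0 ?ltW // !mulVf ?gt_eqF // mulr1 divr1.
by rewrite invfM mulrC.
Qed.

Lemma continuous_sum (R : realType) (T : topologicalType) (I : Type) (r : seq I)
    (P : pred I) (f : I -> T -> R) (x : T) :
  (forall i, P i -> {for x, continuous (f i)}) ->
  {for x, continuous (fun y => \sum_(i <- r | P i) f i y)}.
Proof.
move=> cf; elim: r => [|i r IHr].
  have -> : (fun y => \sum_(i <- [::] | P i) f i y) = cst 0.
    by apply/funext => y; rewrite big_nil.
  exact: cst_continuous.
have -> : (fun y => \sum_(j <- i :: r | P j) f j y) =
    (fun y => (if P i then f i y else 0) + \sum_(j <- r | P j) f j y).
  by apply/funext => y; rewrite [LHS]big_cons; case: (P i); rewrite ?add0r.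
apply: continuousD => //; case Pi: (P i); [exact: cf|exact: cst_continuous].
Qed.

Lemma norm_wedge_continuous (R : realType) n :
  continuous (fun p : 'rV[R]_n * 'rV[R]_n => norm_wedge p.1 p.2).
Proof.
move=> p; rewrite /norm_wedge /l2norm.
apply: (@continuous_comp _ _ _ (fun p : 'rV[R]_n * 'rV[R]_n => _) Num.sqrt);
  last exact: sqrt_continuous.
apply: continuous_sum => ij _.
have cx (k : 'I_n) : {for p, continuous (fun p : 'rV[R]_n * 'rV[R]_n => p.1 0 k)}.
  apply: (@continuous_comp _ _ _ fst (fun x : 'rV[R]_n => x 0 k)).
    exact: cvg_fst.
  exact: coord_continuous.
have cy (k : 'I_n) : {for p, continuous (fun p : 'rV[R]_n * 'rV[R]_n => p.2 0 k)}.
  apply: (@continuous_comp _ _ _ snd (fun x : 'rV[R]_n => x 0 k)).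
    exact: cvg_snd.
  exact: coord_continuous.
have cw : {for p, continuous (fun p : 'rV[R]_n * 'rV[R]_n =>
                     p.1 0 ij.1 * p.2 0 ij.2 - p.1 0 ij.2 * p.2 0 ij.1)}.
  by apply: continuousB; apply: continuousM.
exact: (continuousM cw cw).
Qed.

(** The sphere is a closed part of the cube [-1, 1]^n. *)
Lemma unit_sphere_compact (R : realType) n (A : {vspace 'rV[R]_n}) :
  compact [set x : 'rV[R]_n | x \in A /\ normv x = 1].
Proof.
have box : compact [set v : 'rV[R]_n | forall i, v ord0 i \in `[(-1 : R), 1]].
  by apply: (@rV_compact _ _ (fun=> `[(-1 : R), 1]%classic)) => _; apply: segment_compact.
apply: subclosed_compact box _ => [|x [_ x1] i]; last first.
  have le1 : x 0 i ^+ 2 <= 1.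
    rewrite -[leRHS](expr1n _ 2) -x1 normv_sqr (bigD1 i) //= lerDl.
    by apply: sumr_ge0 => j _; apply: sqr_ge0.
  by rewrite /= in_itv /= -ler_norml -(@ler_pXn2r _ 2) ?nnegrE // expr1n real_normK ?num_real.
(* A is the set of the fixed points of a projector, whose coordinates are
   continuous. *)
have -> : [set x : 'rV[R]_n | x \in A /\ normv x = 1] =
    (\bigcap_(i in [set: 'I_n])
      [set x : 'rV[R]_n | \sum_k x 0 k * (projv A (delta_mx 0 k)) 0 i - x 0 i = 0]) `&`
    [set x | \sum_i x 0 i ^+ 2 = 1].
  have projE (x : 'rV[R]_n) i : \sum_k x 0 k * (projv A (delta_mx 0 k)) 0 i = projv A x 0 i.
    rewrite [in RHS](row_sum_delta x) linear_sum summxE; apply: eq_bigr => k _.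
    by rewrite linearZ mxE.
  apply/seteqP; split=> x /= [xA x1]; split.
  - by move=> i _ /=; rewrite projE projv_id // subrr.
  - by rewrite -normv_sqr x1 expr1n.
  - suff -> : x = projv A x by apply: memv_proj.
    by apply/rowP=> i; have := xA i I; rewrite /= projE => /eqP; rewrite subr_eq0 => /eqP.
  by apply/eqP; rewrite -(@eqrXn2 _ 2) // ?normv_ge0 // normv_sqr x1 expr1n.
apply: closedI.
  apply: closed_bigI => i _.
  apply: (@preimage_closed _ _ (fun x : 'rV[R]_n =>
    \sum_k x 0 k * (projv A (delta_mx 0 k)) 0 i - x 0 i) [set y : R | y = 0]);
    last exact: closed_eq.
  move=> x _; apply: continuousB; last exact: coord_continuous.
  apply: continuous_sum => k _; apply: continuousM; first exact: coord_continuous.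
  exact: cst_continuous.
apply: (@preimage_closed _ _ (fun x : 'rV[R]_n => \sum_i x 0 i ^+ 2) [set y : R | y = 1]);
  last exact: closed_eq.
by move=> x _; apply: continuous_sum => k _; apply: continuousM; apply: coord_continuous.
Qed.

(** The minimum that defines the first angle is attained, by compactness of the
    unit spheres of A and B; so psi A B 1 is the sine of an actual angle. *)
Lemma principal_vectors_exist (R : realType) n (A B : {vspace 'rV[R]_n}) :
    (0 < \dim A)%N -> (0 < \dim B)%N ->
  exists X Y, principal_vectors A B X Y 1.
Proof.
move=> dimA dimB.
have unit_in (U : {vspace 'rV[R]_n}) : (0 < \dim U)%N -> exists x, x \in U /\ normv x = 1.
  move=> dimU; exists ((normv (vpick U))^-1 *: vpick U); split.
    by rewrite memvZ ?memv_pick.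
  have : 0 < normv (vpick U) by rewrite normv_gt0 vpick0 -dimv_eq0 -lt0n.
  by move=> gt0; rewrite normvZ ger0_norm ?invr_ge0 ?ltW // mulVf ?gt_eqF.
have [x0 Sx0] := unit_in A dimA; have [y0 Sy0] := unit_in B dimB.
have cAB := compact_setX (unit_sphere_compact (A := A)) (unit_sphere_compact (A := B)).
have [||[x y]] := compact_EVT_min _ cAB (f := fun p => norm_wedge p.1 p.2).
- by exists (x0, y0).
- by apply: continuous_subspaceT => p; apply: norm_wedge_continuous.
rewrite inE /= => -[[xA x1] [yB y1]] min_xy.
exists (fun=> x), (fun=> y) => k; rewrite ltnS leqn0 => /eqP ->.
have adm (U : {vspace 'rV[R]_n}) z : z \in U -> normv z = 1 -> admissible U (fun=> z) 0 z.
  by move=> zU z1; split=> //; rewrite -normv_gt0 z1.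
split; [by split => //; apply: adm|by split => //; apply: adm|].
move=> a b [aA nza _] [bB nzb _]; rewrite -(sin_angle_normalize nza nzb).
rewrite /sin_angle x1 y1 !normvZ !ger0_norm ?invr_ge0 ?normv_ge0 //.
rewrite !mulVf ?gt_eqF ?normv_gt0 // !mulr1 !divr1.
apply: (min_xy (_, _)); rewrite inE /=.
by split; (split; first by rewrite memvZ);
   rewrite normvZ ger0_norm ?invr_ge0 ?normv_ge0 // mulVf ?gt_eqF ?normv_gt0.
Qed.

(** With t = x . y and |x| = 1, y_k - t x_k is the sum of the x_i (x_i y_k - x_k y_i),
    and each of these minors is a coordinate of the wedge product. *)
Lemma wedge_lower_bound (R : realType) n (x y : 'rV[R]_n) : normv x = 1 ->
  forall k, `|(y - dotv x y *: x) 0 k| <= n%:R * norm_wedge x y.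
Proof.
move=> x1 k; have x_le1 i : `|x 0 i| <= 1.
  rewrite -(@ler_pXn2r _ 2) ?nnegrE // expr1n real_normK ?num_real //.
  rewrite -[leRHS](expr1n _ 2) -x1 normv_sqr (bigD1 i) //= lerDl.
  by apply: sumr_ge0 => j _; apply: sqr_ge0.
have minor_lt (i j : 'I_n) : (i < j)%N ->
    `|x 0 i * y 0 j - x 0 j * y 0 i| <= norm_wedge x y.
  move=> ij; rewrite -(@ler_pXn2r _ 2) ?nnegrE ?sqrtr_ge0 // real_normK ?num_real //.
  rewrite sqr_sqrtr; last by apply: sumr_ge0 => p _; apply: sqr_ge0.
  rewrite (bigD1 (i, j)) //= lerDl; apply: sumr_ge0 => p _; exact: sqr_ge0.
have minor_le i : `|x 0 i * y 0 k - x 0 k * y 0 i| <= norm_wedge x y.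
  have [ik|ki|/val_inj ->] := ltngtP i k; first exact: minor_lt.
    by rewrite distrC minor_lt.
  by rewrite subrr normr0 sqrtr_ge0.
have -> : (y - dotv x y *: x) 0 k = \sum_i x 0 i * (x 0 i * y 0 k - x 0 k * y 0 i).
  have yk : y 0 k = \sum_i x 0 i ^+ 2 * y 0 k.
    by rewrite -mulr_suml -normv_sqr x1 expr1n mul1r.
  rewrite !mxE {1}yk /dotv mulr_suml -sumrB.
  by apply: eq_bigr => i _; ring.
apply: le_trans (ler_norm_sum _ _ _) _.
rewrite -[X in X%:R * _](card_ord n) mulr_natl -sumr_const.
apply: ler_sum => i _; rewrite normrM -[leRHS]mul1r.
exact: ler_pM.
Qed.

(** * Rational subspaces *)

(** A nonzero vector of B is not annihilated by d consecutive folded forms: on a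
    rational basis of B, they have for coefficients conjugates of rational
    combinations of the periods, which are linearly independent over the
    rationals because the folding is injective on B. *)
Lemma rational_subspace_nondegenerate (R : realType) n d m (eta : nat -> R)
    (B : {vspace 'rV[R]_n}) :
    (d <= m)%N -> (m <= n)%N ->
    (forall (a : 'M[rat]_(d, m)) t, row_free a ->
        \det (\matrix_(i < d, j < d)
                \sum_(k < m) ratr (a j k) * eta (t + i + k)%N) != 0) ->
    rational_subspace B -> \dim B = d ->
  exists T : 'I_m -> 'I_n -> bool,
    (forall j (k : 'I_n), (k < m)%N -> T j k = (j == k :> nat)) /\
    (forall t y, y \in B -> hankel_mx eta d m t *m fold_mx R T *m y^T = 0 -> y = 0).
Proof.
move=> le_dm le_mn moore [b basis_b rat_b] dimB.
have size_b : size b == d by rewrite -dimB; case/andP: (basis_b) => /eqP <- /eqnP ->.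
pose X : d.-tuple 'rV[R]_n := Tuple size_b.
have basis_X : basis_of B X by [].
have [T [T_prefix T_inj]] : exists T : 'I_m -> 'I_n -> bool,
    (forall j (k : 'I_n), (k < m)%N -> T j k = (j == k :> nat)) /\
    (forall y, y \in B -> (forall j, \sum_k (T j k)%:R * y 0 k = 0) -> y = 0).
  by apply: exists_injective_folding; rewrite ?dimB.
exists T; split=> // t y yB Ey0.
have b_in (j : 'I_d) : b`_j \in b by rewrite mem_nth ?(eqP size_b).
have [q qE] : exists q : 'M[rat]_(n, d), forall k (j : 'I_d), b`_j 0 k = ratr (q k j).
  have ex_q k (j : 'I_d) : exists q : rat, b`_j 0 k == ratr q.
    by have [q ->] := rat_b _ (b_in j) k; exists q.
  exists (\matrix_(k, j) xchoose (ex_q k j)) => k j; rewrite mxE.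
  exact/eqP/(xchooseP (ex_q k j)).
pose Q : 'M[R]_(n, d) := map_mx ratr q.
have comb_in (v : 'cV[R]_d) : (Q *m v)^T = \sum_(j < d) v j 0 *: b`_j.
  apply/rowP=> k; rewrite !mxE summxE; apply: eq_bigr => j _.
  by rewrite !mxE qE mulrC.
have inB (v : 'cV[R]_d) : (Q *m v)^T \in B.
  rewrite comb_in; apply: memv_suml => j _; rewrite memvZ // -(span_basis basis_b).
  exact: memv_span.
have free_Q (v : 'cV[R]_d) : (Q *m v)^T = 0 -> v = 0.
  rewrite comb_in => v0; apply/colP=> j; rewrite mxE.
  by have /freeP/(_ (fun j => v j 0) v0 j) := basis_free basis_X.
have [v yE] : exists v, y = (Q *m v)^T.
  exists (\col_j coord X j y); rewrite comb_in [LHS](coord_basis basis_X yB).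
  by apply: eq_bigr => j _; rewrite mxE.
pose a := (fold_mx rat T *m q)^T.
(* A rational relation between the rows of a would be a vector of B that the
   folding sends to 0. *)
have free_a : row_free a.
  rewrite -kermx_eq0; apply/rowV0P => w /sub_kermxP wa0.
  have w0 : map_mx ratr w^T = 0 :> 'cV[R]_d.
    apply: free_Q; apply: T_inj => // j.
    have /colP/(_ j) : fold_mx rat T *m q *m w^T = 0.
      by apply: trmx_inj; rewrite trmx_mul trmxK trmx0.
    move/(congr1 (ratr : rat -> R)); rewrite -mulmxA !mxE rmorph_sum rmorph0.
    move=> E0; rewrite -[RHS]E0.
    apply: eq_bigr => k _; rewrite rmorphM /Q -map_mxM !mxE.
    by congr (_ * _); case: (T j k); rewrite ?rmorph1 ?rmorph0.
  apply/rowP=> j; move/colP/(_ j): w0; rewrite !mxE => /eqP.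
  by rewrite fmorph_eq0 => /eqP.
have nz_det := moore a t free_a.
have EQ : hankel_mx eta d m t *m fold_mx R T *m Q =
    \matrix_(i < d, j < d) \sum_(k < m) ratr (a j k) * eta (t + i + k)%N.
  have -> : fold_mx R T = map_mx ratr (fold_mx rat T).
    by apply/matrixP=> i j; rewrite !mxE; case: (T i j); rewrite ?rmorph1 ?rmorph0.
  rewrite -mulmxA -map_mxM; apply/matrixP=> i j; rewrite !mxE.
  by apply: eq_bigr => k _; rewrite !mxE mulrC.
have : v = 0.
  have unitEQ : hankel_mx eta d m t *m fold_mx R T *m Q \in unitmx.
    by rewrite EQ unitmxE unitfE.
  have EQv : hankel_mx eta d m t *m fold_mx R T *m Q *m v = 0.
    by rewrite -mulmxA -[Q *m v]trmxK -yE.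
  by rewrite -[v](mulKmx unitEQ) EQv mulmx0.
by rewrite yE => ->; rewrite mulmx0 trmx0.
Qed.

(** When the height is not 0, it is the norm of a primitive integer vector Xi, and
    all the minors of a basis of B, not only those with increasing indices, are
    proportional to integers bounded by the height. *)
Lemma plucker_data (R : realType) n d (B : {vspace 'rV[R]_n}) :
    \dim B = d -> height B != 0 ->
  exists (M : 'M[R]_(n, d)) (c : R) (z : {ffun 'I_d -> 'I_n} -> int),
  [/\ forall y, y \in B <-> exists v : 'cV_d, y = (M *m v)^T,
      exists f, z f != 0,
      forall f, (z f)%:~R = c * \det (rowsub f M) &
      forall f, `|(z f)%:~R| <= height B].
Proof.
move=> <- nz_h.
have [Xi [[b [c [basis_b nz_c XiE]]] gcd_Xi] hE] :
    exists2 Xi : {ffun 'I_(\dim B) -> 'I_n} -> int, @primitive_plucker R n B Xi &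
      height B = l2norm (@increasing_map _ _) (fun f => (Xi f)%:~R).
  pose S : set R := [set h | exists2 Xi : {ffun 'I_(\dim B) -> 'I_n} -> int,
    @primitive_plucker R n B Xi & h = l2norm (@increasing_map _ _) (fun f => (Xi f)%:~R)].
  have [h Sh] : exists h, S h.
    by apply: contrapT => noS; case/eqP: nz_h; apply: xgetPN => h Sh; apply: noS; exists h.
  by have [Xi prim_Xi hE] : S (height B) := xgetI 0 Sh; exists Xi.
have incrP (g : {ffun 'I_(\dim B) -> 'I_n}) :
    (forall i j : 'I_(\dim B), (i < j)%N -> (g i < g j)%N) -> increasing_map g.
  by move=> g_incr; apply/forallP => i; apply/forallP => j; apply/implyP/g_incr.
have Xi_le g : increasing_map g -> `|(Xi g)%:~R : R| <= height B.
  move=> g_incr; rewrite hE -(@ler_pXn2r _ 2) ?nnegrE ?sqrtr_ge0 //.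
  rewrite real_normK ?num_real // sqr_sqrtr; last first.
    by apply: sumr_ge0 => f _; apply: sqr_ge0.
  rewrite (bigD1 g) //= lerDl; apply: sumr_ge0 => f _; exact: sqr_ge0.
have ex_z (f : {ffun 'I_(\dim B) -> 'I_n}) : exists k : int,
    (k%:~R == c * \det (rowsub f (basis_mx b))) && (`|k%:~R : R| <= height B).
  have [->|[g [s [/incrP g_incr ->]]]] := det_rowsub_sort (basis_mx b) f.
    by exists 0; rewrite mulr0 eqxx normr0 hE sqrtr_ge0.
  exists ((-1) ^+ s * Xi g); rewrite rmorphM /= rmorph_sign; apply/andP; split.
    by rewrite XiE // mulrCA.
  by rewrite normrM normr_sign mul1r Xi_le.
exists (basis_mx b), c, (fun f => xchoose (ex_z f)).
have zP f := xchooseP (ex_z f).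
split=> [y||f|f].
- have vE (v : 'cV[R]_(\dim B)) : (basis_mx b *m v)^T = \sum_j v j 0 *: tnth b j.
    apply/rowP=> k; rewrite !mxE summxE; apply: eq_bigr => j _.
    by rewrite !mxE mulrC.
  split=> [yB|[v ->]].
    exists (\col_j coord b j y); rewrite vE (coord_basis basis_b yB).
    by apply: eq_bigr => j _; rewrite -(coord_basis basis_b yB) mxE (tnth_nth 0).
  rewrite vE; apply: memv_suml => j _; rewrite memvZ //.
  exact: (basis_mem basis_b (mem_tnth j b)).
- have [f /andP[f_incr nz_f]] : exists f, increasing_map f && (Xi f != 0).
    apply/existsP; rewrite -[[exists _, _]]negbK negb_exists; apply/negP=> /forallP Xi0.
    move: gcd_Xi; rewrite big1 // => f f_incr.
    by have := Xi0 f; rewrite f_incr /= negbK => /eqP ->.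
  exists f; have /andP[/eqP zE _] := zP f.
  by rewrite -(intr_eq0 R) zE -XiE // intr_eq0.
- by have /andP[/eqP zE _] := zP f.
by have /andP[] := zP f.
Qed.

(** * The badly approximable subspace *)

(** A is the image in R^n of the common kernel in R^m of L_0, ..., L_(d-1), forms that
    are independent by the Moore criterion.  On A a folding restricts to the
    projection to the first m coordinates, whichever folding it is. *)
Lemma exists_hankel_kernel (R : realType) n d m (eta : nat -> R) :
    (d <= m)%N -> (m <= n)%N ->
    (forall (a : 'M[rat]_(d, m)) t, row_free a ->
        \det (\matrix_(i < d, j < d)
                \sum_(k < m) ratr (a j k) * eta (t + i + k)%N) != 0) ->
  exists A : {vspace 'rV[R]_n}, \dim A = (m - d)%N /\
    forall (T : 'I_m -> 'I_n -> bool) x,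
      (forall j (k : 'I_n), (k < m)%N -> T j k = (j == k :> nat)) ->
      x \in A -> hankel_mx eta d m 0 *m fold_mx R T *m x^T = 0.
Proof.
move=> le_dm le_mn moore; pose C := hankel_mx eta d m 0.
have [D CD1] : exists D, D *m C^T = 1%:M.
  pose a : 'M[rat]_(d, m) := pid_mx d.
  have free_a : row_free a by rewrite /row_free rank_pid_mx.
  have := moore a 0%N free_a; set X := (X in \det X) => nz_X.
  have XE : X = C *m (map_mx ratr a)^T.
    apply/matrixP=> i j; rewrite !mxE; apply: eq_bigr => k _.
    by rewrite !mxE mulrC.
  exists (invmx X^T *m map_mx ratr a).
  have unitX : X^T \in unitmx by rewrite unitmxE unitfE det_tr.
  by rewrite -mulmxA -[map_mx ratr a]trmxK -trmx_mul -XE mulVmx.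
pose h : 'Hom('rV[R]_m, 'rV[R]_d) := linfun (mulmxr C^T).
pose T0 (j : 'I_m) (k : 'I_n) := j == k :> nat.
pose g : 'Hom('rV[R]_m, 'rV[R]_n) := linfun (mulmxr (fold_mx R T0)).
have foldK (T : 'I_m -> 'I_n -> bool) :
    (forall j (k : 'I_n), (k < m)%N -> T j k = (j == k :> nat)) ->
    fold_mx R T *m (fold_mx R T0)^T = 1%:M.
  move=> T_prefix; apply/matrixP=> i j; rewrite !mxE.
  rewrite (bigD1 (widen_ord le_mn j)) //= !mxE T_prefix /T0 //= eqxx mulr1.
  rewrite big1 ?addr0 // => k nkj; rewrite !mxE /T0.
  have /negPf-> : (j != k :> nat); last by rewrite mulr0.
  by apply: contra nkj => /eqP jk; apply/eqP/val_inj.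
have g_inj : lker g == 0%VS.
  apply/lker0P => x y; rewrite !lfunE /= => /(congr1 (fun z => z *m (fold_mx R T0)^T)).
  by rewrite -!mulmxA foldK // !mulmx1.
exists (g @: lker h)%VS; split.
  have := limg_ker_dim h fullv; rewrite capfv dimvf /dim /= mul1n.
  have -> : limg h = fullv.
    apply/vspaceP => y; rewrite memvf; apply/memv_imgP.
    by exists (y *m D); rewrite ?memvf // lfunE /= -mulmxA CD1 mulmx1.
  rewrite dimvf /dim /= mul1n => dim_h.
  rewrite limg_dim_eq ?(eqP g_inj) ?capv0 //.
  by apply: (@addIn d); rewrite dim_h subnK.
move=> T x T_prefix /memv_imgP[u]; rewrite memv_ker !lfunE /= => /eqP uC ->.
rewrite trmx_mul -mulmxA (mulmxA (fold_mx R T)) foldK // mul1mx.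
by apply: trmx_inj; rewrite trmx_mul trmxK trmx0.
Qed.

(** Let x in A and y in B be unit vectors that realise the first angle, and
    t = x . y.  The folded forms vanish at t x, so their values at y are those at
    y - t x, of size O(|x /\ y|).  Two separate consequences are drawn: by
    nondegeneracy |x /\ y| is not 0, and when the height is the norm of an integer
    vector, hankel_lower_bound applies. *)
Lemma psi_lower_bound (R : realType) n d m (eta : nat -> R) (A : {vspace 'rV[R]_n}) :
    (0 < m)%N -> (0 < d <= m)%N -> (m <= n)%N ->
    (forall k, eta (k + m)%N = eta k) ->
    (forall (a : 'M[rat]_(d, m)) t, row_free a ->
        \det (\matrix_(i < d, j < d)
                \sum_(k < m) ratr (a j k) * eta (t + i + k)%N) != 0) ->
    (forall c : {ffun 'I_d -> 'I_m} -> int, exists N : int,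
        \prod_(t < m) (\sum_f (c f)%:~R * \prod_(i < d) eta (t + i + f i)%N) = N%:~R) ->
    \dim A = d ->
    (forall (T : 'I_m -> 'I_n -> bool) x,
      (forall j (k : 'I_n), (k < m)%N -> T j k = (j == k :> nat)) ->
      x \in A -> hankel_mx eta d m 0 *m fold_mx R T *m x^T = 0) ->
  exists2 c0 : R, 0 < c0 &
    forall B : {vspace 'rV[R]_n}, rational_subspace B -> \dim B = d ->
    [/\ (A :&: B)%VS = 0%VS, 0 < psi A B 1 &
        height B != 0 -> c0 <= psi A B 1 * height B ^+ m].
Proof.
move=> m_gt0 /andP[d_gt0 le_dm] le_mn eta_per moore eta_norm dimA kerA.
have [c0 c0_gt0 lower] := hankel_lower_bound n m_gt0 eta_per eta_norm.
have [K K_ge0 eta_le] := periodic_bounded m_gt0 eta_per.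
have n_gt0 : (0 < n)%N by apply: leq_trans le_mn.
pose Q := n%:R * (m%:R * K * n%:R) + 1.
have Q_gt0 : 0 < Q by rewrite ltr_wpDl ?mulr_ge0.
exists (c0 / Q); first exact: divr_gt0.
move=> B rat_B dimB.
have [T [T_prefix nondeg]] := rational_subspace_nondegenerate le_dm le_mn moore rat_B dimB.
have capAB x : x \in A -> x \in B -> x = 0.
  by move=> xA xB; apply: (nondeg 0%N) => //; apply: kerA.
have [x [y [[[xA nz_x _] x1] [[yB nz_y _] y1] psiE]]] : exists x y,
    [/\ admissible A (fun=> x) 0 x /\ normv x = 1,
        admissible B (fun=> y) 0 y /\ normv y = 1 &
        psi A B 1 = norm_wedge x y].
  have [||X [Y XY]] := @principal_vectors_exist R n A B; rewrite ?dimA ?dimB //.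
  pose S : set R := [set r | exists X Y, principal_vectors A B X Y 1 /\
                                         r = sin_angle (X 0%N) (Y 0%N)].
  have SXY : S (sin_angle (X 0%N) (Y 0%N)) by exists X, Y.
  have [X' [Y' [XY' ->]]] : S (psi A B 1) := xgetI 0 SXY.
  have [[[X'A nzX' _] X'1] [[Y'B nzY' _] Y'1] _] := XY' 0%N isT.
  by exists (X' 0%N), (Y' 0%N); rewrite /sin_angle X'1 Y'1 mulr1 divr1.
pose w := norm_wedge x y.
have w_ge0 : 0 <= w by apply: sqrtr_ge0.
have dist k := wedge_lower_bound y x1 k.
pose e : R := m%:R * K * n%:R * (n%:R * w).
pose E := hankel_mx eta d m 0 *m fold_mx R T.
have Ey : E *m y^T = E *m (y - dotv x y *: x)^T.
  by rewrite linearB linearZ /= mulmxBr -scalemxAr (kerA T x) // scaler0 subr0.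
have Ey_le i : `|(E *m y^T) i 0| <= e.
  rewrite Ey mxE; apply: le_trans (ler_norm_sum _ _ _) _.
  apply: (@le_trans _ _ (\sum_(k < n) m%:R * K * (n%:R * w))); last first.
    by rewrite sumr_const card_ord -[leLHS]mulr_natr /e mulrAC.
  apply: ler_sum => k _; rewrite normrM [_^T k 0]mxE; apply: ler_pM => //.
  rewrite mxE; apply: le_trans (ler_norm_sum _ _ _) _.
  apply: (@le_trans _ _ (\sum_(j < m) K)); last by rewrite sumr_const card_ord -[leLHS]mulr_natl.
  apply: ler_sum => j _; rewrite !mxE normrM normr_nat.
  by case: (T j k); rewrite ?mulr1 ?mulr0.
have psi_gt0 : 0 < psi A B 1.
  rewrite psiE -/w lt_def w_ge0 andbT; apply: contra nz_y => /eqP w0.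
  apply/eqP/(nondeg 0%N) => //; rewrite -/E; apply/colP=> i; rewrite [RHS]mxE.
  by apply/eqP; rewrite -normr_le0 (le_trans (Ey_le i)) // /e w0 !mulr0.
split=> //.
  apply/eqP; rewrite -subv0; apply/subvP => z; rewrite memv_cap => /andP[zA zB].
  by rewrite memv0 (capAB z).
move=> nz_h; have [M [c [z [inB nz_z zE z_le]]]] := plucker_data dimB nz_h.
have [v yE] := (inB y).1 yB.
(* Some coordinate of a unit vector is at least n^(-1/2), hence 1/n, in absolute
   value. *)
have [k yk] : exists k, n%:R^-1 <= `|(M *m v) k 0|.
  apply: contrapT => noK; have y_lt k : `|y 0 k| < n%:R^-1.
    by rewrite ltNge yE mxE; apply/negP => le_k; apply: noK; exists k.
  have n_inv_le1 : n%:R^-1 <= 1 :> R by rewrite invf_le1 ?ltr0n ?ler1n.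
  have := normv_sqr y; rewrite y1 expr1n => /eqP; rewrite eq_sym lt_eqF //.
  apply: (@lt_le_trans _ _ (\sum_(k < n) n%:R^-1)); last first.
    by rewrite sumr_const card_ord -[leLHS]mulr_natl divff // pnatr_eq0 -lt0n.
  apply: ltr_sum => [|k _]; last first.
    rewrite -real_normK ?num_real // expr2.
    apply: le_lt_trans (_ : _ <= `|y 0 k| * 1) _; last by rewrite mulr1.
    by rewrite ler_wpM2l // (le_trans (ltW (y_lt k))).
  by apply/hasP; exists (Ordinal n_gt0); rewrite ?mem_index_enum.
have h_ge0 : 0 <= height B by have [f _] := nz_z; apply: le_trans (z_le f).
have M_inj (u : 'cV[R]_d) : M *m u = 0 -> u = 0.
  have [f nz_zf] := nz_z => Mu0.
  have unitM : rowsub f M \in unitmx.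
    rewrite unitmxE unitfE; apply: contraNneq nz_zf => det0.
    by rewrite -(intr_eq0 R) zE det0 mulr0.
  apply: (can_inj (mulKmx unitM)); rewrite mulmx0.
  have -> : rowsub f M *m u = rowsub f (M *m u).
    by apply/matrixP=> i j; rewrite !mxE; apply: eq_bigr => l _; rewrite !mxE.
  by rewrite Mu0; apply/matrixP=> i j; rewrite !mxE.
have lower_e : c0 <= e * height B ^+ m.
  apply: (lower T M c _ z zE nz_z z_le _ v k) => // [t u Eu0|i].
    apply: M_inj; apply: trmx_inj; rewrite trmx0; apply: (nondeg t).
      by apply/inB; exists u.
    by rewrite trmxK mulmxA.
  by have := Ey_le i; rewrite yE trmxK mulmxA.
rewrite psiE -/w ler_pdivrMr // (le_trans lower_e) //.
rewrite [leRHS]mulrAC; apply: ler_wpM2r; first exact: exprn_ge0.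
rewrite /e /Q mulrDr mulr1 -[leLHS]addr0; apply: lerD => //.
by rewrite le_eqVlt; apply/orP; left; apply/eqP; ring.
Qed.

(** * Finiteness and the exponent *)

(** B is spanned by d integer vectors whose coordinates are bounded by its height:
    the columns of the reduced basis for a nonzero minor z f1, multiplied by
    z f1, have Pluecker coordinates for entries. *)
Lemma northcott (R : realType) n d (H0 : R) :
  finite_set [set B : {vspace 'rV[R]_n} |
    [/\ \dim B = d, height B != 0 & height B <= H0]].
Proof.
pose N := Num.bound `|H0|.
have H0N : H0 <= N%:R by apply: le_trans (ler_norm _) (ltW (archi_boundP _)).
(* Integers between -N and N, encoded as ordinals. *)
pose decode (o : 'I_(N + N).+1) : int := o%:Z - N%:Z.
have decodeP (x : int) : (absz x <= N)%N -> exists o, decode o = x.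
  move=> xN; have lt_o : (absz (x + N%:Z)%R < (N + N).+1)%N by lia.
  by exists (Ordinal lt_o); rewrite /decode /=; lia.
pose V (X : 'M['I_(N + N).+1]_(d, n)) : {vspace 'rV[R]_n} :=
  (\sum_(j < d) <[\row_k (decode (X j k))%:~R]>)%VS.
apply: (@sub_finite_set _ _ (V @` [set: 'M['I_(N + N).+1]_(d, n)])); last first.
  exact: finite_image.
move=> B /= [dimB nz_h h_le].
have [M [c [z [inB [f1 nz_z] zE z_le]]]] := plucker_data dimB nz_h.
pose f j k : {ffun 'I_d -> 'I_n} := [ffun i => if i == j then k else f1 i].
have ex_o j k : exists o, decode o == z (f j k).
  have [|o <-] := decodeP (z (f j k)); last by exists o.
  rewrite -(ler_nat R); apply: le_trans H0N; apply: le_trans h_le.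
  by rewrite natr_absz intr_norm z_le.
pose X := \matrix_(j, k) xchoose (ex_o j k).
have XE j k : decode (X j k) = z (f j k).
  by rewrite mxE; apply/eqP/(xchooseP (ex_o j k)).
exists X => //.
have nz_f1 : \det (rowsub f1 M) != 0.
  by apply: contraNneq nz_z => d0; rewrite -(intr_eq0 R) zE d0 mulr0.
have unit1 : rowsub f1 M \in unitmx by rewrite unitmxE unitfE.
pose W := invmx (rowsub f1 M).
have rowE j k : (decode (X j k))%:~R = (z f1)%:~R * (M *m W) k j.
  by rewrite XE !zE mulmx_inv_rowsub // -mulrA; congr (_ * _);
     rewrite mulrCA divff // mulr1.
apply/eqP; rewrite eqEsubv; apply/andP; split.
  apply/subv_sumP => j _; rewrite -memvE; apply/inB.
  exists ((z f1)%:~R *: col j W); apply/rowP=> k.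
  rewrite mxE rowE -scalemxAr !mxE; congr (_ * _).
  by apply: eq_bigr => l _; rewrite !mxE.
apply/subvP => y /inB[v ->].
have -> : (M *m v)^T = \sum_(j < d)
    (((rowsub f1 M *m v) j 0) / (z f1)%:~R) *: \row_k (decode (X j k))%:~R.
  rewrite -[in LHS](mulmxKV unit1 M) -(mulmxA _ (rowsub f1 M) v); set t := rowsub f1 M *m v.
  apply/rowP=> k; rewrite [LHS]mxE [LHS]mxE summxE; apply: eq_bigr => j _.
  rewrite [RHS]mxE [X in _ = _ * X]mxE rowE.
  by rewrite mulrA divfK ?intr_eq0 // mulrC.
by apply: memv_sumr => j _; rewrite memvZ ?memv_line.
Qed.

(** A lower bound psi >= c0 H^(-m) for the first angle excludes every exponent
    b > m: with psi <= H^(-b) it gives H^(b-m) <= 1/c0, so H is bounded. *)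
Lemma mu_le (R : realType) n d m (A : {vspace 'rV[R]_n}) (c0 : R) : 0 < c0 ->
    (forall B : {vspace 'rV[R]_n}, rational_subspace B -> \dim B = d ->
      0 < psi A B 1 /\ (height B != 0 -> c0 <= psi A B 1 * height B ^+ m)) ->
  (mu A d 1 <= m%:R%:E)%E.
Proof.
move=> c0_gt0 lower; apply: ge_ereal_sup => _ /= [b [b_gt0 inf_b] <-].
rewrite lee_fin leNgt; apply/negP => lt_mb; apply: inf_b.
have bm_gt0 : 0 < b - m%:R by rewrite subr_gt0.
apply: sub_finite_set (northcott n d (c0^-1 `^ (b - m%:R)^-1)) => B /= [[rat_B dimB] psi_le].
have [psi_gt0 lowerB] := lower B rat_B dimB.
(* At height 0, the upper bound for psi would be 0. *)
have nz_h : height B != 0.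
  apply: contraTneq psi_gt0 => h0; rewrite -leNgt (le_trans psi_le) // h0.
  by rewrite powR0 // oppr_eq0 gt_eqF.
split=> //.
have h_gt0 : 0 < height B.
  rewrite lt_def nz_h; have [M [c [z [_ [f _] _ z_le]]]] := plucker_data dimB nz_h.
  exact: le_trans (z_le f).
have c0_le : c0 <= height B `^ (m%:R - b).
  apply: le_trans (lowerB nz_h) _.
  have -> : height B `^ (m%:R - b) = height B `^ (- b) * height B ^+ m.
    by rewrite addrC powRD ?nz_h ?implybT // powR_mulrn // ltW.
  by apply: ler_wpM2r => //; rewrite exprn_ge0 // ltW.
have h_le : height B `^ (b - m%:R) <= c0^-1.
  rewrite -opprB powRN -[leRHS]invrK.
  by rewrite lef_pV2 ?posrE ?invrK // powR_gt0.
have -> : height B = (height B `^ (b - m%:R)) `^ (b - m%:R)^-1.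
  by rewrite -powRrM mulfV ?gt_eqF // powRr1 // ltW.
by apply: ge0_ler_powR; rewrite ?nnegrE ?powR_ge0 // invr_ge0 ltW.
Qed.

Theorem proposition5p7 (R : realType) (n d : nat)
    (hn : (6 <= n)%N) (hd : (3 <= d <= n./2)%N) :
  (mu_ring R n d d 1 <= ((2 * d)%N%:R%:E : \bar R))%E.
Proof.
have [d_ge3 d_le] := andP hd.
have d_gt0 : (0 < d)%N by apply: leq_trans d_ge3.
have m_gt0 : (0 < 2 * d)%N by rewrite muln_gt0.
have le_dm : (d <= 2 * d)%N by rewrite leq_pmull.
have le_mn : (2 * d <= n)%N.
  by rewrite mul2n -geq_half_double.
have [eta [eta_per moore eta_norm]] := real_gaussian_periods R m_gt0.
have [A [dimA kerA]] := exists_hankel_kernel le_dm le_mn (moore d).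
have {}dimA : \dim A = d by rewrite dimA mul2n -addnn addnK.
have d_bounds : (0 < d <= 2 * d)%N by rewrite d_gt0.
have [c0 c0_gt0 lower] :=
  psi_lower_bound m_gt0 d_bounds le_mn eta_per (moore d) (eta_norm d) dimA kerA.
(* The infimum is at most the exponent of A, which belongs to the family because
   A :&: B = 0 for every rational B of dimension d. *)
apply: (@le_trans _ _ (mu A d 1)).
  apply: ereal_inf_lbound; exists A => //; split=> // B [rat_B dimB].
  by have [-> _ _] := lower B rat_B dimB; rewrite dimv0.
apply: (mu_le c0_gt0) => B rat_B dimB.
by have [_ ? ?] := lower B rat_B dimB.
Qed.
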